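(* Let $n\ge 5$. Among all $n$-vertex bicyclic graphs having exactly two cycles, the graph $S_n^{3,3}$ has the minimum degree resistance distance, i.e. $D_R(G)\ge D_R(S_n^{3,3})$ for every such graph $G$, and $$D_R(S_n^{3,3})=3n^2-\frac{13}{3}n-\frac{32}{3}.$$
   Context: All graphs are finite, simple and connected. For vertices $u,v$ of a graph $G$, the resistance distance $r(u,v)$ is the effective resistance between $u$ and $v$ in the electrical network obtained from $G$ by replacing every edge by a unit resistor. The degree resistance distance of $G$ is $D_R(G)=\sum_{\{u,v\}\subseteq V(G)}[d(u)+d(v)]\,r(u,v)$, where $d(u)$ is the degree of $u$ and the sum runs over unordered pairs of distinct vertices. A bicyclic graph is a connected graph with $|E(G)|=|V(G)|+1$. $S_n^{3,3}$ is the graph obtained from two triangles sharing exactly one common vertex by attaching $n-5$ pendent edges to that common vertex. *)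

(* Defs.v *)
From mathcomp Require Import all_boot all_order all_algebra.
From mathcomp Require Import boolp classical_sets reals.
From mathcomp Require Import ring lra.

Set Implicit Arguments.
Unset Strict Implicit.
Unset Printing Implicit Defensive.

Import Order.TTheory GRing.Theory Num.Theory.
Local Open Scope ring_scope.

Section Graphs.
Variables (T : finType) (e : rel T).

Definition simple_graph : Prop := symmetric e /\ irreflexive e.

Definition connected_graph : Prop := forall x y : T, connect e x y.

Definition edges : {set {set T}} :=
  [set [set p.1; p.2] | p : T * T & e p.1 p.2].

Definition degree (x : T) : nat := #|[set y | e x y]|.

Definition bicyclic : Prop := connected_graph /\ #|edges| = #|T|.+1.

(* A cycle is identified with its edge set, so that the starting point and
   the orientation of the closed walk [c] do not matter. *)
Definition is_cycle (C : {set {set T}}) : Prop :=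
  exists c : seq T, [/\ ucycle e c, (2 < size c)%N &
                        C = [set [set x; next c x] | x in c]].

Definition exactly_two_cycles : Prop :=
  exists C1 C2 : {set {set T}},
    [/\ is_cycle C1, is_cycle C2, C1 <> C2 &
        forall C, is_cycle C -> C = C1 \/ C = C2].

Variable R : realType.

(* [phi] is an electric potential for a unit current entering the network at
   [u] and leaving it at [v]: by Ohm's law the current along a (unit
   resistance) edge from [w] to [x] is [phi w - phi x], and Kirchhoff's current
   law holds at every vertex. *)
Definition unit_current_potential (u v : T) (phi : T -> R) : Prop :=
  forall w, \sum_(x | e w x) (phi w - phi x) = (w == u)%:R - (w == v)%:R.

(* The potential difference of a unit current from [u] to [v]. In a connected
   graph it exists and is unique (see [unit_current_potential_ex] and
   [resistanceP]), so the default value 0 of [xget] is irrelevant. *)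
Definition resistance (u v : T) : R :=
  xget 0 [set r | exists2 phi, unit_current_potential u v phi
                             & r = phi u - phi v].

(* [enum_rank] selects one ordering of every unordered pair. *)
Definition degree_resistance_distance : R :=
  \sum_(u : T) \sum_(v : T | (enum_rank u < enum_rank v)%N)
    (degree u + degree v)%:R * resistance u v.

End Graphs.

(* Vertex 0 is the common vertex; the triangles are {0, 1, 2} and {0, 3, 4},
   and the vertices 5, ..., n - 1 are pendent. *)
Definition S33 (n : nat) : rel 'I_n :=
  fun i j => (i != j) &&
    [|| val i == 0%N, val j == 0%N |
        (val i, val j) \in [:: (1, 2); (2, 1); (3, 4); (4, 3)]%N].
Arguments S33 n : clear implicits.

Section ResistanceWellDefined.
Variables (T : finType) (e : rel T) (R : realType).
Hypothesis e_sym : symmetric e.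
Hypothesis e_conn : connected_graph e.

Lemma harmonic_constant (phi : T -> R) :
  (forall w, \sum_(x | e w x) (phi w - phi x) = 0) ->
  forall x y, phi x = phi y.
Proof.
move=> harm.
have E0 : \sum_w \sum_(x | e w x) (phi w - phi x) ^+ 2 = 0.
  have H1 : \sum_w \sum_(x | e w x) phi w * (phi w - phi x) = 0.
    by apply: big1 => w _; rewrite -mulr_sumr harm mulr0.
  have H2 : \sum_w \sum_(x | e w x) - (phi x * (phi w - phi x)) = 0.
    rewrite (exchange_big_dep xpredT) //= -[RHS]H1.
    apply: eq_bigr => w _; apply: eq_big => [x|x _]; first by rewrite e_sym.
    by rewrite -mulrN opprB.
  transitivity (\sum_w \sum_(x | e w x) phi w * (phi w - phi x)
    + \sum_w \sum_(x | e w x) - (phi x * (phi w - phi x))); last first.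
    by rewrite H1 H2 addr0.
  rewrite -big_split /=; apply: eq_bigr => w _.
  rewrite -big_split /=; apply: eq_bigr => x _.
  by rewrite -mulrBl expr2.
have adj x y : e x y -> phi x = phi y.
  move=> exy; apply/eqP; rewrite -subr_eq0 -sqrf_eq0; apply/eqP.
  have sq_ge0 w : 0 <= \sum_(z | e w z) (phi w - phi z) ^+ 2.
    by apply: sumr_ge0 => *; apply: sqr_ge0.
  have Ex := psumr_eq0P (fun w _ => sq_ge0 w) E0.
  exact: (psumr_eq0P (fun z _ => sqr_ge0 (phi x - phi z)) (Ex x isT)).
move=> x y; case/connectP: (e_conn x y) => p; elim: p x => [|z p IH] x /=.
  by move=> _ ->.
by case/andP=> /adj -> /IH; apply.
Qed.

Lemma unit_current_potential_ex (u v : T) :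
  exists phi : T -> R, unit_current_potential e u v phi.
Proof.
pose N := #|T|.
pose lap (f : T -> R) w := \sum_(x | e w x) (f w - f x).
pose L : 'M[R]_N := \matrix_(i, j)
  lap (fun x => (x == enum_val i)%:R) (enum_val j).
have LE (a : 'rV[R]_N) j :
    (a *m L) 0 j = lap (fun x => a 0 (enum_rank x)) (enum_val j).
  have aE x : a 0 (enum_rank x) = \sum_i a 0 i * (x == enum_val i)%:R.
    rewrite (bigD1 (enum_rank x)) //= enum_rankK eqxx mulr1 big1 ?addr0 //.
    move=> i; rewrite eq_sym => ni; case: eqP => [xi|_]; last by rewrite mulr0.
    by rewrite xi enum_valK eqxx in ni.
  rewrite mxE /lap; under eq_bigr do rewrite mxE mulr_sumr.
  rewrite exchange_big /=; apply: eq_bigr => x _.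
  rewrite !aE -sumrB; apply: eq_bigr => i _; by rewrite mulrBr.
pose o : 'cV[R]_N := const_mx 1.
have Lo : L *m o = 0.
  apply/matrixP => i k; rewrite !mxE.
  under eq_bigr => j _ do rewrite [o _ _]mxE mulr1 mxE.
  pose f x : R := (x == enum_val i)%:R.
  rewrite (_ : \sum_j _ = \sum_w lap f w); last first.
    rewrite (reindex (@enum_val T xpredT)) //=.
    by exists enum_rank => x _; rewrite ?enum_valK ?enum_rankK.
  have S : \sum_w lap f w = - \sum_w lap f w.
    rewrite /lap [LHS](exchange_big_dep xpredT) //= -sumrN.
    apply: eq_bigr => w _; rewrite -sumrN.
    by apply: eq_big => [x|x _]; [rewrite e_sym | rewrite opprB].
  by apply/eqP; move/eqP: S; rewrite -addr_eq0 -mulr2n mulrn_eq0.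
have N0 : (0 < N)%N by apply/card_gt0P; exists u.
have rko : \rank o = 1%N.
  apply/eqP; rewrite eqn_leq rank_leq_col lt0n mxrank_eq0.
  apply/eqP => /matrixP /(_ (Ordinal N0) 0) /eqP.
  by rewrite !mxE oner_eq0.
have rkK : (\rank (kermx L) <= 1)%N.
  rewrite -rko -(mxrank_tr o).
  apply: mxrankS; apply/row_subP => i.
  have : row i (kermx L) *m L = 0 by apply/sub_kermxP/row_sub.
  move: (row i _) => a aL.
  have h w : lap (fun x => a 0 (enum_rank x)) w = 0.
    by rewrite -[w]enum_rankK -LE aL mxE.
  have -> : a = a 0 (Ordinal N0) *: o^T.
    apply/rowP => j; rewrite !mxE mulr1.
    have := harmonic_constant h (enum_val j) (enum_val (Ordinal N0)).
    by rewrite !enum_valK.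
  exact: scalemx_sub.
have LK : (kermx o <= L)%MS.
  have LsK : (L <= kermx o)%MS by apply/sub_kermxP.
  rewrite -(geq_leqif (mxrank_leqif_sup LsK)) mxrank_ker rko.
  by move: rkK; rewrite mxrank_ker !leq_subLR addnC.
pose d : 'rV[R]_N :=
  \row_j ((enum_val j == u)%:R - (enum_val j == v)%:R).
have dK : (d <= kermx o)%MS.
  apply/sub_kermxP/matrixP => i k; rewrite !mxE.
  under eq_bigr => j _ do rewrite [o _ _]mxE mulr1 mxE.
  have s1 z : \sum_(j < N) ((enum_val j == z)%:R : R) = 1.
    rewrite (bigD1 (enum_rank z)) //= enum_rankK eqxx big1 ?addr0 //.
    move=> j nj; case: eqP => // jz.
    by rewrite -jz enum_valK eqxx in nj.
  by rewrite sumrB !s1 subrr.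
case/submxP: (submx_trans dK LK) => a da.
exists (fun x => a 0 (enum_rank x)) => w.
have := LE a (enum_rank w); rewrite -da mxE /lap enum_rankK => <- //.
Qed.

Lemma resistanceP (u v : T) (phi : T -> R) :
  unit_current_potential e u v phi -> resistance e R u v = phi u - phi v.
Proof.
move=> phiP; rewrite /resistance; case: xgetP => [r _ [psi psiP ->]|]; last first.
  by move=> /(_ (phi u - phi v)) []; exists phi.
have /(_ u v) : forall x y, psi x - phi x = psi y - phi y.
  apply: (@harmonic_constant (fun x => psi x - phi x)) => w.
  rewrite -[RHS](subrr ((w == u)%:R - (w == v)%:R : R)).
  rewrite -{1}psiP -phiP -sumrB; apply: eq_bigr => x _.
  by ring.
by move=> h; lra.
Qed.

End ResistanceWellDefined.

(* Main.v *)
(* Every graph of the family is built from one vertex by attaching pendent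
   vertices and cycles, each along a single vertex, with exactly two cycles in
   all. Resistances add up at a cut vertex, so the effect of one attachment at w
   on D = sum_(u, v) d(v) r(u, v) is an explicit expression in
   R(w) = sum_v r(w, v) and W(w) = sum_v d(v) r(w, v). Lower bounds for D, R and
   W are carried along the construction; for R and W it suffices that a pendent
   vertex adds at least 1 to either of them, and a cycle of length L at least
   (L^2 - 1) / 6 to R and (L^2 - 1) / 3 to W.
   That such a construction exists is shown by dismantling the graph: if there
   is no pendent vertex, all degrees are at least 2 and exceed 2 by at most two
   in total, and a parity argument yields a cycle which is attached to the rest
   at one vertex only. *)
Require Import Defs.
From mathcomp Require Import all_boot all_order all_algebra.
From mathcomp Require Import reals.
From mathcomp Require Import ring lra zify.

Set Implicit Arguments.
Unset Strict Implicit.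
Unset Printing Implicit Defensive.

Import Order.TTheory GRing.Theory Num.Theory.
Local Open Scope ring_scope.

(** * Potentials and attachments along a vertex *)

(** Handshake lemma: ordered adjacent pairs are grouped by the edge they span, and each group has
    two members since there are no loops. *)
Lemma sum_degree (T : finType) (e : rel T) :
  symmetric e -> irreflexive e -> (\sum_x degree e x = 2 * #|edges e|)%N.
Proof.
move=> e_sym e_irr.
have -> : (\sum_x degree e x = \sum_(p : T * T | e p.1 p.2) 1)%N.
  rewrite /degree; under eq_bigr do rewrite -sum1dep_card.
  by rewrite pair_big_dep.
rewrite (partition_big (fun p : T * T => [set p.1; p.2]) (fun E => E \in edges e)) /=; last first.
  by move=> p ep; apply/imsetP; exists p; rewrite ?inE.
rewrite mulnC -sum_nat_const; apply: eq_bigr => _ /imsetP[[a b] /= eab ->].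
have nab : (a, b) != (b, a) by apply/eqP => -[ab _]; rewrite inE /= ab e_irr in eab.
rewrite sum1dep_card.
have <- : #|[set (a, b); (b, a)]| = 2%N by rewrite cards2 nab.
apply: eq_card => -[x y]; rewrite !inE /= !xpair_eqE; apply/andP/orP.
  move=> [exy /eqP E].
  have := set21 x y; have := set22 x y; rewrite E !inE.
  have nxy : x != y by apply/eqP => xy; rewrite xy e_irr in exy.
  move=> /orP[] /eqP yE /orP[] /eqP xE; move: nxy; rewrite yE xE ?eqxx //; by [right|left].
rewrite inE /= in eab.
by move=> [] /andP[/eqP-> /eqP->]; [rewrite eab eqxx | rewrite e_sym eab setUC eqxx].
Qed.

Section Potentials.
Variables (T : finType) (R : realType).
Implicit Types (e : rel T) (f g phi : T -> R).

Definition laplacian e phi w : R := \sum_(x | e w x) (phi w - phi x).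

(** The difference of the two sides sums the antisymmetric [h] over ordered adjacent pairs, so it
    equals its own negative. *)
Lemma laplacian_selfadjoint e f g : symmetric e ->
  \sum_w f w * laplacian e g w = \sum_w g w * laplacian e f w.
Proof.
move=> e_sym; apply/eqP; rewrite -subr_eq0 -sumrB; apply/eqP.
pose h w x := g w * f x - f w * g x.
transitivity (\sum_w \sum_(x | e w x) h w x).
  apply: eq_bigr => w _; rewrite /laplacian !mulr_sumr -sumrB.
  by apply: eq_bigr => x _; rewrite /h; ring.
have S : \sum_w \sum_(x | e w x) h w x = - \sum_w \sum_(x | e w x) h w x.
  rewrite [LHS](exchange_big_dep xpredT) //= -sumrN; apply: eq_bigr => w _.
  rewrite -sumrN; apply: eq_big => [x|x _]; [by rewrite e_sym | rewrite /h; ring].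
lra.
Qed.

(** Twice the energy is the sum of [(f w - f x) ^+ 2] over ordered adjacent pairs. *)
Lemma energy_ge0 e f : symmetric e -> 0 <= \sum_w f w * laplacian e f w.
Proof.
move=> e_sym.
pose h w x := f w * (f w - f x).
have E : \sum_w f w * laplacian e f w = \sum_w \sum_(x | e w x) h w x.
  by apply: eq_bigr => w _; rewrite mulr_sumr.
have E' : \sum_w f w * laplacian e f w = \sum_w \sum_(x | e w x) h x w.
  rewrite E (exchange_big_dep xpredT) //=; apply: eq_bigr => w _.
  by apply: eq_bigl => x; rewrite e_sym.
suff : 0 <= \sum_w f w * laplacian e f w + \sum_w f w * laplacian e f w by lra.
rewrite {1}E E' -big_split /= sumr_ge0 // => w _; rewrite -big_split /= sumr_ge0 //.
by move=> x _; have := sqr_ge0 (f w - f x); rewrite /h; nra.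
Qed.

Lemma sum_delta_in (A : {set T}) (f : T -> R) u :
  u \in A -> \sum_(w in A) f w * (w == u)%:R = f u.
Proof.
move=> uA; rewrite (bigD1 u) //= eqxx mulr1 big1 ?addr0 // => w /andP[_ /negbTE ->].
by rewrite mulr0.
Qed.

Lemma sum_delta (f : T -> R) u : \sum_w f w * (w == u)%:R = f u.
Proof.
rewrite -[RHS](sum_delta_in f (in_setT u)).
by apply: eq_bigl => w; rewrite inE.
Qed.

Lemma sum_unit_source (f : T -> R) u v :
  \sum_w f w * ((w == u)%:R - (w == v)%:R) = f u - f v.
Proof.
by under eq_bigr do rewrite mulrBr; rewrite sumrB !sum_delta.
Qed.

Lemma unit_current_potentialB e u v w f g :
  unit_current_potential e u w f -> unit_current_potential e v w g ->
  unit_current_potential e u v (fun x => f x - g x).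
Proof.
move=> fP gP x; transitivity (laplacian e f x - laplacian e g x).
  by rewrite -sumrB; apply: eq_bigr => y _; ring.
by rewrite /laplacian fP gP; ring.
Qed.

(** Characterises [rho] through potentials, so that one fixed [rho] serves a graph and all its
    dismantled subgraphs. Existence is included because the second clause alone could hold
    vacuously. *)
Definition resistance_on (V : {set T}) e (rho : T -> T -> R) :=
  forall u v, u \in V -> v \in V ->
    (exists phi, unit_current_potential e u v phi) /\
    (forall phi, unit_current_potential e u v phi -> rho u v = phi u - phi v).

Definition transmission (V : {set T}) (rho : T -> T -> R) y := \sum_(v in V) rho y v.

Definition weighted_transmission (V : {set T}) e (rho : T -> T -> R) y :=
  \sum_(v in V) (degree e v)%:R * rho y v.

(** The two orders of a pair together contribute (d(u) + d(v)) r(u, v), so on the whole graph this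
    is the degree resistance distance. *)
Definition total_resistance (V : {set T}) e (rho : T -> T -> R) :=
  \sum_(y in V) weighted_transmission V e rho y.

Section Resistance.
Variables (V : {set T}) (e : rel T) (rho : T -> T -> R).
Hypotheses (e_sym : symmetric e) (rhoP : resistance_on V e rho).

(** The resistance is the energy of the unit current potential. *)
Lemma resistance_on_ge0 u v : u \in V -> v \in V -> 0 <= rho u v.
Proof.
move=> uV vV; have [[phi phiP] /(_ _ phiP) ->] := rhoP uV vV.
rewrite -sum_unit_source; under eq_bigr do rewrite -phiP.
exact: energy_ge0.
Qed.

Lemma resistance_on_sym u v : u \in V -> v \in V -> rho u v = rho v u.
Proof.
move=> uV vV; have [[phi phiP] /(_ _ phiP) ->] := rhoP uV vV.
have [_ /(_ (fun x => - phi x)) ->] := rhoP vV uV; first by ring.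
move=> w; rewrite -opprB -phiP -sumrN; apply: eq_bigr => x _; ring.
Qed.

Lemma resistance_on_id u : u \in V -> rho u u = 0.
Proof.
by move=> uV; have [[phi phiP] /(_ _ phiP) ->] := rhoP uV uV; rewrite subrr.
Qed.

End Resistance.
End Potentials.

(** The vertex type stays [T]: the vertices of [B] become isolated, and the current vertex set is
    tracked separately. *)
Definition induced_off (T : finType) (e : rel T) (B : {set T}) : rel T :=
  [rel x y | [&& e x y, x \notin B & y \notin B]].

(* [B] hangs at the vertex [w]: [g k] is the potential of a unit current from
   [k] to [w]. Both a pendent vertex (delta = 1) and a cycle all of whose
   vertices but [w] have degree 2 (delta = 2) are of this form. *)
Record attachment (T : finType) (R : realType) (V : {set T}) (e : rel T)
    (B : {set T}) (w : T) (delta : nat) (S : R) (g : T -> T -> R) : Prop := {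
  att_sub : B \subset V;
  att_rootV : w \in V;
  att_rootB : w \notin B;
  att_edge : forall k y, k \in B -> e k y -> (y \in B) || (y == w);
  att_green0 : forall k x, k \in B -> x \notin B -> g k x = 0;
  att_green : forall k, k \in B -> unit_current_potential e k w (g k);
  att_degree : forall k, k \in B -> degree e k = delta;
  att_root_degree : #|[set k in B | e w k]| = delta;
  att_trace : \sum_(k in B) g k k = S;
  att_row : forall k, k \in B ->
    \sum_(j in B) (g k k + g j j - g k j - g j k) = S - g k k
}.

(** * Resistances, degrees and transmissions when an attachment is removed *)

Section Attachment.
Variables (T : finType) (R : realType).
Variables (V : {set T}) (e : rel T) (rho : T -> T -> R).
Hypotheses (e_sym : symmetric e) (rhoP : resistance_on V e rho).
Variables (B : {set T}) (w : T) (delta : nat) (S : R) (g : T -> T -> R).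
Hypothesis att : attachment V e B w delta S g.

Let BV := att_sub att.
Let wV := att_rootV att.
Let wB := att_rootB att.
Let eB := att_edge att.
Let g0 := att_green0 att.
Let gP := att_green att.

Let V' := V :\: B.

Let wV' : w \in V'. Proof. by rewrite !inE wB. Qed.

Let e_out x y : x \notin B -> y \in B -> e x y -> x = w.
Proof. by move=> xB yB; rewrite e_sym => /(eB yB); rewrite (negbTE xB) => /eqP. Qed.

(** No current enters [B]: by self-adjointness, pairing [phi] with the Laplacian of [g k] gives
    [phi k - phi w] = [g k u - g k v], and [g k] vanishes off [B]. *)
Lemma attachment_constant u v (phi : T -> R) k : u \notin B -> v \notin B -> k \in B ->
  unit_current_potential e u v phi -> phi k = phi w.
Proof.
move=> uB vB kB phiP; apply/eqP; rewrite -subr_eq0 -(sum_unit_source phi).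
under eq_bigr do rewrite -(gP kB).
rewrite laplacian_selfadjoint //; under eq_bigr do rewrite /laplacian phiP.
by rewrite sum_unit_source !g0 // subrr.
Qed.

(** The edges from [w] into [B] carry no current, so a potential of the larger graph remains one
    after they are deleted. *)
Lemma attachment_resistance : resistance_on V' (induced_off e B) rho.
Proof.
move=> u v; rewrite !inE => /andP[uB uV] /andP[vB vV].
have [[phi phiP] uniP] := rhoP uV vV; split.
  exists phi; move=> x; have [xB|xB] := boolP (x \in B).
    rewrite big_pred0 => [|y]; last by rewrite /induced_off /= xB andbF.
    have -> : x == u = false by apply: contraNF uB => /eqP <-.
    have -> : x == v = false by apply: contraNF vB => /eqP <-.
    by rewrite subrr.
  rewrite -phiP [RHS](bigID (mem B)) /= [X in _ = X + _]big1 ?add0r => [|y /andP[exy yB]].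
    by apply: eq_bigl => y; rewrite /induced_off /= xB.
  by rewrite (e_out xB yB exy) (attachment_constant uB vB yB phiP) subrr.
(* Conversely, a potential of the smaller graph extends to [B] by its value at [w]. *)
move=> psi psiP; pose f x := if x \in B then psi w else psi x.
suff fP : @unit_current_potential T e R u v f.
  by rewrite (uniP _ fP) /f (negbTE uB) (negbTE vB).
move=> x; rewrite -psiP /f; have [xB|xB] := boolP (x \in B).
  rewrite big1 ?big_pred0 // => [y|y /(eB xB)]; first by rewrite /induced_off /= xB andbF.
  by case: (y \in B) => /= [_|/eqP ->]; rewrite subrr.
rewrite [LHS](bigID (mem B)) /= big1 ?add0r => [|y /andP[exy yB]].
  apply: eq_big => [y|y /andP[_ /negbTE ->] //].
  by rewrite /induced_off /= xB.
by rewrite yB (e_out xB yB exy) subrr.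
Qed.

(** Series law at the cut vertex: a potential from [u] to [w] minus [g k] is a potential from [u] to
    [k]. *)
Lemma attachment_rho_out u k : u \in V' -> k \in B -> rho u k = rho u w + g k k.
Proof.
rewrite !inE => /andP[uB uV] kB.
have [[phi phiP] uni] := rhoP uV wV.
have [_ /(_ _ (unit_current_potentialB phiP (gP kB))) ->] := rhoP uV (subsetP BV _ kB).
by rewrite (uni _ phiP) (attachment_constant uB wB kB phiP) (g0 kB uB); ring.
Qed.

Lemma attachment_rho_in j k : j \in B -> k \in B ->
  rho j k = g j j + g k k - g j k - g k j.
Proof.
move=> jB kB; have [_ /(_ _ (unit_current_potentialB (gP jB) (gP kB))) ->] :=
  rhoP (subsetP BV _ jB) (subsetP BV _ kB); ring.
Qed.

Let e' := induced_off e B.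

Lemma attachment_degree u : u \in V' -> degree e u = (degree e' u + delta * (u == w))%N.
Proof.
rewrite !inE => /andP[uB uV].
rewrite /degree -(cardsID B [set y | e u y]) addnC; congr addn.
  by apply: eq_card => y; rewrite !inE /e' /induced_off /= uB andbC.
case: eqP => [->|/eqP uw]; rewrite (muln1, muln0).
  by rewrite -(att_root_degree att); apply: eq_card => y; rewrite !inE andbC.
apply: eq_card0 => y; rewrite !inE; apply/negbTE/negP => /andP[euy yB].
by rewrite (e_out uB yB euy) eqxx in uw.
Qed.

Lemma big_attachment (M : nmodType) (F : T -> M) :
  \sum_(v in V) F v = \sum_(v in V') F v + \sum_(k in B) F k.
Proof. by rewrite (big_setID B) (setIidPr BV) addrC. Qed.

Lemma card_attachment : #|V| = (#|V'| + #|B|)%N.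
Proof. by rewrite -(cardsID B V) (setIidPr BV) addnC. Qed.

(** Deletion removes degree [delta] at each vertex of [B] and once more at [w]. *)
Lemma volume_attachment :
  (\sum_(v in V) degree e v = \sum_(v in V') degree e' v + delta * #|B|.+1)%N.
Proof.
rewrite (@big_attachment nat) /= mulnS addnA; congr addn.
  rewrite (eq_bigr _ attachment_degree) big_split /=; congr addn.
  rewrite (bigD1 w) //= eqxx muln1 big1 ?addr0 // => v /andP[_ /negbTE ->].
  by rewrite muln0.
by rewrite mulnC -sum_nat_const; apply: eq_bigr => k /(att_degree att).
Qed.

Let volume' : R := (\sum_(v in V') degree e' v)%:R.

Lemma rho_root k : k \in B -> rho w k = g k k.
Proof.
by move=> kB; rewrite (attachment_rho_out wV' kB) (resistance_on_id rhoP) // add0r.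
Qed.

Lemma transmission_root_side y : y \in V' ->
  transmission V rho y = transmission V' rho y + #|B|%:R * rho y w + S.
Proof.
move=> yV; rewrite /transmission big_attachment -addrA; congr (_ + _).
rewrite (eq_bigr (fun k => rho y w + g k k)) => [|k kB]; last exact: attachment_rho_out.
by rewrite big_split /= sumr_const (att_trace att) mulr_natl.
Qed.

Lemma rho_out_sym k v : k \in B -> v \in V' -> rho k v = rho w v + g k k.
Proof.
move=> kB vV; have vV1 : v \in V by move: vV; rewrite inE => /andP[].
rewrite (resistance_on_sym rhoP (subsetP BV _ kB) vV1) attachment_rho_out //.
by rewrite (resistance_on_sym rhoP vV1 wV).
Qed.

(** As [g k k] is the resistance between [k] and [w], the resistances from [k] to [B] and [w]
    together sum to [S], just as they do from [w]. *)
Lemma sum_rho_in k : k \in B -> \sum_(j in B) rho k j = S - g k k.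
Proof.
by move=> kB; rewrite -(att_row att kB); apply: eq_bigr => j; apply: attachment_rho_in.
Qed.

Lemma transmission_far_side k : k \in B ->
  transmission V rho k = transmission V' rho w + (#|V'|%:R - 1) * g k k + S.
Proof.
move=> kB; rewrite /transmission big_attachment (eq_bigr _ (fun v => @rho_out_sym k v kB)).
rewrite big_split /= sumr_const sum_rho_in // -(mulr_natl (g k k)); ring.
Qed.

Lemma weighted_root_side y : y \in V' ->
  weighted_transmission V e rho y =
  weighted_transmission V' e' rho y + (delta * #|B|.+1)%:R * rho y w + delta%:R * S.
Proof.
move=> yV; rewrite /weighted_transmission big_attachment.
rewrite (eq_bigr (fun v => (degree e' v)%:R * rho y v +
    delta%:R * (rho y v * (v == w)%:R))) => [|v vV]; last first.
  by rewrite attachment_degree // natrD natrM; ring.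
rewrite big_split /= -mulr_sumr sum_delta_in //.
rewrite [X in _ + X = _](eq_bigr (fun k => delta%:R * (rho y w + g k k))) => [|k kB]; last first.
  by rewrite (att_degree att) // attachment_rho_out.
rewrite -mulr_sumr big_split sumr_const /= (att_trace att) -mulr_natl natrM -natr1; ring.
Qed.

Lemma weighted_far_side k : k \in B ->
  weighted_transmission V e rho k =
  weighted_transmission V' e' rho w + volume' * g k k + delta%:R * S.
Proof.
move=> kB; rewrite /weighted_transmission big_attachment.
rewrite (eq_bigr (fun v => (degree e' v)%:R * rho w v + (degree e' v)%:R * g k k +
    delta%:R * ((rho w v + g k k) * (v == w)%:R))) => [|v vV]; last first.
  by rewrite attachment_degree // rho_out_sym // natrD natrM; ring.
rewrite !big_split /= -mulr_suml -natr_sum -mulr_sumr sum_delta_in //.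
rewrite [X in _ + X = _](eq_bigr (fun j => delta%:R * rho k j)) => [|j jB]; last first.
  by rewrite (att_degree att).
rewrite -mulr_sumr sum_rho_in // (resistance_on_id rhoP wV) /volume'; ring.
Qed.

(** The rows of [V'] produce the transmission term, those of [B] the weighted one; both contribute
    multiples of [S]. *)
Lemma total_attachment :
  total_resistance V e rho = total_resistance V' e' rho
    + (delta * #|B|.+1)%:R * transmission V' rho w
    + #|B|%:R * weighted_transmission V' e' rho w
    + S * (volume' + (delta * (#|V'| + #|B|))%:R).
Proof.
rewrite /total_resistance big_attachment (eq_bigr _ weighted_root_side).
rewrite (eq_bigr _ weighted_far_side) !big_split /= !sumr_const -!mulr_sumr.
rewrite (att_trace att) -[delta%:R * S *+ #|V'|]mulr_natl -[delta%:R * S *+ #|B|]mulr_natl.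
rewrite -[_ *+ #|B|]mulr_natl (eq_bigr (F1 := fun v => rho v w) (fun v => rho w v)) => [|v]; last first.
  by rewrite inE => /andP[_ vV]; rewrite (resistance_on_sym rhoP).
rewrite -/(transmission V' rho w) -/(total_resistance V' e' rho) !natrM natrD -natr1; ring.
Qed.

End Attachment.

(** * Pendent vertices and pendent cycles *)

Lemma leaf_attachment (T : finType) (R : realType) (V : {set T}) (e : rel T) a w :
    symmetric e -> irreflexive e -> (forall x y, e x y -> x \in V) ->
    degree e a = 1%N -> e a w ->
  attachment V e [set a] w 1 (1 : R) (fun _ x => (x == a)%:R).
Proof.
move=> e_sym e_irr eV da eaw.
have aw : a != w by apply/eqP => aw; rewrite aw e_irr in eaw.
have ea y : e a y = (y == w).
  have /eqP/cards1P[z Ez] := da.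
  have Ey x : e a x = (x == z) by rewrite -in_set1 -Ez inE.
  by move: eaw; rewrite !Ey => /eqP ->.
split.
- by rewrite sub1set (eV _ w).
- by rewrite (eV _ a) // e_sym.
- by rewrite inE eq_sym.
- by move=> k y /set1P ->; rewrite ea => ->; rewrite orbT.
- by move=> k x _; rewrite inE => /negbTE ->.
- move=> k /set1P -> z; case: (eqVneq z a) => [->|za].
    rewrite (eq_bigl (pred1 w)) => [|y]; last by rewrite ea.
    by rewrite big_pred1_eq (negbTE aw) eq_sym (negbTE aw).
  rewrite sub0r; under eq_bigr do rewrite sub0r; rewrite sumrN; congr (- _).
  rewrite -natr_sum; congr (_ %:R).
  case: (eqVneq z w) => [->|zw].
    rewrite (bigD1 a) /=; last by rewrite e_sym.
    by rewrite eqxx big1 // => x /andP[_ /negbTE ->].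
  rewrite big1 // => x ezx; case: eqP => // xa.
  by move: ezx; rewrite xa e_sym ea (negbTE zw).
- by move=> k /set1P ->.
- apply/eqP/cards1P; exists a; apply/setP => x; rewrite !inE e_sym.
  by case: eqP => // ->; rewrite eaw.
- by rewrite big_set1 eqxx.
- by move=> k /set1P ->; rewrite big_set1 eqxx !subrr; ring.
Qed.

(** * Green function of a cycle grounded at one vertex *)

Section CycleGreen.
Variable R : realType.

(** Green function of the path 0, ..., L with both ends grounded; identifying the ends gives the
    cycle of length L grounded at one vertex. *)
Definition cycle_green (L i j : nat) : R :=
  (minn i j)%:R * (L - maxn i j)%:R / L%:R.

Lemma cycle_green_le L i j : (i <= j <= L)%N ->
  cycle_green L i j = i%:R * (L%:R - j%:R) / L%:R.
Proof.
by case/andP=> ij jL; rewrite /cycle_green (minn_idPl ij) (maxn_idPr ij) natrB.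
Qed.

Lemma cycle_greenC L i j : cycle_green L i j = cycle_green L j i.
Proof. by rewrite /cycle_green minnC maxnC. Qed.

Lemma cycle_green_ge L i j : (j <= i <= L)%N ->
  cycle_green L i j = j%:R * (L%:R - i%:R) / L%:R.
Proof. by move=> h; rewrite cycle_greenC cycle_green_le. Qed.

Lemma cycle_green0 L i : cycle_green L i 0 = 0.
Proof. by rewrite /cycle_green minn0 !mul0r. Qed.

Lemma cycle_greenL L i : cycle_green L i L = 0.
Proof. by rewrite /cycle_green (_ : (L - maxn i L = 0)%N) ?mulr0 ?mul0r //; lia. Qed.

(** As a function of [j] it is linear on either side of [i], and its slope drops by 1 at [i]. *)
Lemma cycle_green_laplacian L i j : (0 < i < L)%N -> (0 < j < L)%N ->
  (cycle_green L i j - cycle_green L i j.-1) + (cycle_green L i j - cycle_green L i j.+1)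
  = (j == i)%:R.
Proof.
move=> iL jL.
have L0 : L%:R != 0 :> R by rewrite pnatr_eq0; lia.
have jp : j%:R = j.-1%:R + 1 :> R by rewrite natr1 prednK //; lia.
have js : j.+1%:R = j.-1%:R + 1 + 1 :> R by rewrite -natr1 jp.
case: (ltngtP j i) => ij; rewrite ?mulr0n ?mulr1n.
- by rewrite !cycle_green_ge ?js ?jp; try lia; field.
- by rewrite !cycle_green_le ?js ?jp; try lia; field.
- rewrite (@cycle_green_le L i j.+1) ?(@cycle_green_ge L i j) ?(@cycle_green_ge L i j.-1); try lia.
  by rewrite -ij js jp; field.
Qed.

Lemma sum_cycle_green L i : (i < L)%N ->
  \sum_(0 <= j < L) cycle_green L i j = i%:R * (L%:R - i%:R) / 2.
Proof.
move=> iL; have L0 : L%:R != 0 :> R by rewrite pnatr_eq0; lia.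
(* Partial sums: [low] as far as the kink at [i], [high] beyond it. *)
have low m : (m <= i.+1)%N -> \sum_(0 <= j < m) cycle_green L i j
    = m%:R * (m%:R - 1) / 2 * (L%:R - i%:R) / L%:R.
  elim: m => [|m IH] mi; first by rewrite big_geq // !mul0r.
  rewrite big_nat_recr //= IH ?cycle_green_ge -?natr1; try lia.
  by field.
have high m : (i + m <= L)%N -> \sum_(0 <= j < i + m) cycle_green L i j
    = i%:R * (i%:R - 1) / 2 * (L%:R - i%:R) / L%:R
      + i%:R * (m%:R * (L%:R - i%:R) - m%:R * (m%:R - 1) / 2) / L%:R.
  elim: m => [|m IH] mi; first by rewrite addn0 low //; field.
  rewrite addnS big_nat_recr //= IH ?cycle_green_le ?natrD -?natr1; try lia.
  by field.
have := high (L - i)%N; rewrite (subnKC (ltnW iL)) natrB ?(ltnW iL) // => -> //.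
by field.
Qed.

Lemma sum_cycle_green_diag L : (0 < L)%N ->
  \sum_(0 <= j < L) cycle_green L j j = (L%:R ^+ 2 - 1) / 6.
Proof.
move=> L_gt0; have L0 : L%:R != 0 :> R by rewrite pnatr_eq0; lia.
have part m : (m <= L)%N -> \sum_(0 <= j < m) cycle_green L j j
    = m%:R * (m%:R - 1) / 2 - m%:R * (m%:R - 1) * (2 * m%:R - 1) / 6 / L%:R.
  elim: m => [|m IH] mi; first by rewrite big_geq //; field.
  rewrite big_nat_recr //= IH ?cycle_green_le -?natr1; try lia.
  by field.
by rewrite part //; field.
Qed.

End CycleGreen.

(** * A cycle meeting the rest of the graph in one vertex *)

Section CycleAttachment.
Variables (T : finType) (R : realType) (V : {set T}) (e : rel T) (w : T) (s : seq T).
Hypothesis e_sym : symmetric e.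
Hypothesis eV : forall x y, e x y -> x \in V.
Hypotheses (cP : ucycle e (w :: s)) (c3 : (2 < size (w :: s))%N).
Hypothesis s2 : forall x, x \in s -> degree e x = 2%N.

Let c := w :: s.
Let L := size c.
(** The default value [w] makes [v L] equal to [v 0], so indices 0 to L run once around the cycle
    without reduction modulo L. *)
Let v j := nth w c j.

Let L3 : (2 < L)%N := c3.

Let LE : L = (size s).+1. Proof. by []. Qed.

Let vL : v L = w. Proof. exact: nth_default. Qed.

Let index_v j : (j < L)%N -> index (v j) c = j.
Proof. by move=> jL; rewrite index_uniq //; case/andP: cP. Qed.

Let v_inj i j : (i < L)%N -> (j < L)%N -> v i = v j -> i = j.
Proof. by move=> iL jL E; rewrite -(index_v iL) E index_v. Qed.

Let v_eq i j : (i < L)%N -> (j < L)%N -> (v i == v j) = (i == j).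
Proof. by move=> iL jL; apply/eqP/eqP => [/v_inj|->]; auto. Qed.

Let adj j : (j < L)%N -> e (v j) (v j.+1).
Proof.
move=> jL; have /andP[/(pathP w)/(_ j)] := cP; rewrite size_rcons => /(_ jL).
rewrite -rcons_cons !nth_rcons -/c -/L jL -[v j.+1]/(nth w s j) -/(v j) => + _.
case: ltngtP => // [|->]; first by rewrite [(size s < j)%N]ltnNge -ltnS jL.
by rewrite (@nth_default _ w s).
Qed.

Let in_s x : x \in s -> exists2 j, (0 < j < L)%N & x = v j.
Proof.
move=> xs; exists (index x s).+1; first by rewrite /= ltnS index_mem.
by rewrite /v /= nth_index.
Qed.

Let v_s j : (0 < j < L)%N -> v j \in s.
Proof. by case: j => // j jL; rewrite /v /= mem_nth. Qed.

Let v_succ_neq j : (0 < j < L)%N -> v j.-1 != v j.+1.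
Proof.
move=> jL; case: (ltngtP j.+1 L) => h; [by rewrite v_eq; lia | lia |].
by rewrite h vL -[w]/(v 0) v_eq; lia.
Qed.

Let nbr j y : (0 < j < L)%N -> e (v j) y = (y == v j.-1) || (y == v j.+1).
Proof.
move=> jL; suff -> : e (v j) y = (y \in [set v j.-1; v j.+1]) by rewrite !inE.
have /eqP -> : [set v j.-1; v j.+1] == [set z | e (v j) z]; last by rewrite inE.
  rewrite eqEcard cards2 v_succ_neq // [#|_|](s2 (v_s jL)) andbT.
  apply/subsetP => z; rewrite !inE => /orP[]/eqP->; last by rewrite adj; lia.
  by rewrite e_sym -{2}(@prednK j) ?adj; lia.
Qed.

Let root_nbr x : x \in s -> e w x = (x == v 1) || (x == v L.-1).
Proof.
move=> /in_s[j jL ->]; rewrite e_sym nbr // -{1}vL -[in w == v j.+1]vL.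
have -> : (v L == v j.-1) = (v j == v 1).
  by rewrite vL -[w]/(v 0) !v_eq; lia.
congr (_ || _).
case: (ltngtP j.+1 L) => h; try lia; last by rewrite -h /= !eqxx.
by rewrite vL -[w]/(v 0) !v_eq; lia.
Qed.

(** A vertex off the cycle gets index L and [w] gets index 0; the Green function vanishes at
    both. *)
Definition cycle_potential (k x : T) : R :=
  cycle_green R (size (w :: s)) (index k (w :: s)) (index x (w :: s)).

Let potential_v i j : (0 < i < L)%N -> (j <= L)%N ->
  cycle_potential (v i) (v j) = cycle_green R L i j.
Proof.
move=> iL jL; rewrite /cycle_potential -/c index_v -/L; last by lia.
case: (ltngtP j L) => h; try lia; first by rewrite index_v.
by rewrite h vL cycle_greenL /= eqxx cycle_green0.
Qed.

Let potential_off k x : x \notin s -> cycle_potential k x = 0.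
Proof.
move=> xs; rewrite /cycle_potential; case: (eqVneq x w) => [->|xw].
  by rewrite /= eqxx cycle_green0.
by rewrite [index x _]memNindex ?cycle_greenL // in_cons negb_or xw.
Qed.

Let big_s (F : nat -> R) :
  \sum_(x in [set x in s]) F (index x c) = \sum_(1 <= j < L) F j.
Proof.
have us : uniq s by case/andP: cP => _ /= /andP[].
rewrite (eq_bigl (mem s)) => [|x]; last by rewrite inE.
rewrite -big_uniq // (big_nth w) big_add1 big_nat [RHS]big_nat.
by apply: eq_bigr => j /andP[_ js]; rewrite -[nth w s j]/(v j.+1) index_v.
Qed.

Lemma cycle_attachment : attachment V e [set x in s] w 2
  (((size (w :: s))%:R ^+ 2 - 1) / 6) cycle_potential.
Proof.
have ws : w \notin s by case/andP: cP => _ /= /andP[].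
split.
- by apply/subsetP => x; rewrite inE => /in_s[j /andP[_ jL] ->]; exact: eV (adj jL).
- exact: eV (@adj 0%N isT).
- by rewrite inE.
- move=> k y; rewrite inE => /in_s[j jL ->]; rewrite nbr // inE.
  have vc i : (v i \in s) || (v i == w).
    rewrite orbC -in_cons; case: (ltnP i L) => [|iL]; first exact: mem_nth.
    by rewrite /v nth_default // mem_head.
  by case/orP => /eqP ->.
- by move=> k x; rewrite !inE => _; exact: potential_off.
- move=> k; rewrite inE => /in_s[i iL ->] z.
  have viw : (v i == w) = false by apply: contraNF ws => /eqP <-; apply: v_s.
  have [/in_s[j jL ->]|zs] := boolP (z \in s).
    rewrite (eq_bigl (mem [set v j.-1; v j.+1])) => [|y]; last by rewrite nbr // !inE.
    rewrite big_setU1 ?inE ?v_succ_neq //= big_set1 !potential_v; try lia.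
    have -> : (v j == w) = false by apply: contraNF ws => /eqP <-; apply: v_s.
    rewrite cycle_green_laplacian // subr0; congr (_ %:R).
    by rewrite v_eq; lia.
  have -> : (z == v i) = false by apply: contraNF zs => /eqP ->; apply: v_s.
  (* At [w] the current arrives through [v 1] and [v L.-1] only, in the amounts (L - i)/L and i/L;
     the other neighbours have potential 0. *)
  rewrite potential_off // sub0r; case: (eqVneq z w) => [zw|zw].
    rewrite (bigID (mem s)) /= [X in _ + X]big1 ?addr0; last first.
      by move=> x /andP[_ xs]; rewrite potential_off // subr0.
    rewrite (eq_bigl (mem [set v 1; v L.-1])) => [|y]; last first.
      rewrite zw !inE; case: (boolP (y \in s)) => ys; first by rewrite root_nbr // andbT.
      by rewrite andbF; apply/esym/negbTE; apply: contra ys => /orP[]/eqP->; apply: v_s; lia.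
    rewrite big_setU1 ?big_set1 /=; last first.
      by rewrite inE v_eq; lia.
    rewrite !potential_v ?(@cycle_green_ge _ L i 1) ?(@cycle_green_le _ L i (size s)); try lia.
    have L0 : L%:R != 0 :> R by rewrite pnatr_eq0.
    have Lp : (size s)%:R = L%:R - 1 :> R by rewrite LE -natr1 addrK.
    by rewrite Lp ?mulr0n ?mulr1n; field.
  (* A vertex off the cycle has no neighbour in [s]. *)
  rewrite big1 ?oppr0 // => x ezx; rewrite potential_off ?subr0 //.
  apply: contra zs => /in_s[j jL xj]; move: ezx; rewrite xj e_sym nbr //.
  move=> /orP[]/eqP zj; move: zw; rewrite zj.
    case: j jL {xj zj} => [|[|j]] // jL; [by rewrite eqxx | by move=> _; apply: v_s; lia].
  case: (ltngtP j.+1 L) => h; [by move=> _; apply: v_s; lia | lia | by rewrite h vL eqxx].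
- by move=> k; rewrite inE => /s2.
- transitivity #|[set v 1; v L.-1]|; last first.
    by rewrite cards2 v_eq; lia.
  apply: eq_card => y; rewrite !inE.
  case: (boolP (y \in s)) => ys; first by rewrite root_nbr.
  by apply/esym/negbTE; apply: contra ys => /orP[]/eqP->; apply: v_s; lia.
- rewrite (big_s (fun j => cycle_green R L j j)) -sum_cycle_green_diag //.
  by rewrite [RHS]big_ltn // cycle_green0 add0r.
(* With G(i,i) = i(L - i)/L and row sum i(L - i)/2, the left side is (L - 1) G(i,i) + S - i(L - i) =
   S - G(i,i). *)
- move=> k; rewrite inE => /in_s[i iL ->].
  rewrite (big_s (fun j => cycle_green R L (index (v i) c) (index (v i) c)
    + cycle_green R L j j - cycle_green R L (index (v i) c) j
    - cycle_green R L j (index (v i) c))).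
  rewrite /cycle_potential -/c -/L index_v; last by lia.
  have := sum_cycle_green_diag R (isT : 0 < L)%N.
  rewrite big_ltn // cycle_green0 add0r => <-.
  rewrite [LHS](eq_bigr (fun j => cycle_green R L i i + cycle_green R L j j
    - cycle_green R L i j - cycle_green R L i j)); last by move=> j _; rewrite (cycle_greenC _ L j i).
  rewrite !sumrB big_split /= sumr_const_nat -mulr_natl.
  have row : \sum_(1 <= j < L) cycle_green R L i j = i%:R * (L%:R - i%:R) / 2.
    by rewrite -sum_cycle_green; [rewrite [RHS]big_ltn // cycle_green0 add0r | lia].
  rewrite row.
  have L0 : L%:R != 0 :> R by rewrite pnatr_eq0.
  rewrite cycle_green_le; last by lia.
  by rewrite natrB //; field.
Qed.

End CycleAttachment.

(** * Dismantling a graph with two cycles *)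

Lemma first_hit (T : eqType) (f : rel T) p (t s : seq T) :
    path f p t -> uniq (p :: t) -> has (mem s) t ->
  exists u r, [/\ path f p (rcons u r), uniq (p :: rcons u r), r \in s &
                  forall x, x \in u -> x \notin s].
Proof.
move=> pt ut ht; case: {ht}(split_find ht) pt ut => r u t2 rs uNs.
rewrite cat_path -cat_cons cat_uniq => /andP[pu _] /andP[uu _].
exists u, r; split=> // x xu; apply: contra uNs => xs.
by apply/hasP; exists x.
Qed.

Section Cycles.
Variables (T : finType) (e : rel T).
Hypotheses (e_sym : symmetric e) (e_irr : irreflexive e).

(** A path is prolonged at its front: the front vertex has a neighbour other than the next path
    vertex, which is either new or closes a cycle. Prolongation must stop, as [T] is finite. *)
Lemma cycle_of_min_degree2 (V : {set T}) x0 :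
    (forall x y, e x y -> x \in V) -> (forall x, x \in V -> (1 < degree e x)%N) ->
  x0 \in V -> exists2 c, ucycle e c & (2 < size c)%N.
Proof.
move=> eV d2 x0V.
have grow m : (exists2 c, ucycle e c & (2 < size c)%N) \/
    (exists x p, [/\ path e x p, uniq (x :: p), size p = m & x \in V]).
  elim: m => [|m [IH|[x [p [xp up sp xV]]]]]; [by right; exists x0, [::] | by left |].
  have nbr y : exists2 z, z != y & e x z.
    have := d2 x xV; rewrite /degree (cardsD1 y) => h.
    have /card_gt0P[z] : (0 < #|[set z | e x z] :\ y|)%N.
      by move: h; case: (y \in _); lia.
    by rewrite !inE => /andP[zy exz]; exists z.
  have [z zy exz] := nbr (head x p).
  have [zp|zp] := boolP (z \in x :: p); last first.
    right; exists z, (x :: p); split; [|by rewrite /= zp|by rewrite /= sp|].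
      by rewrite /= e_sym exz.
    by apply: (eV _ x); rewrite e_sym.
  left; move: zp; rewrite inE; case: eqP => [zx|_ /= zp].
    by rewrite zx e_irr in exz.
  case: p xp up zp zy {sp} => // y p /= /andP[exy yp] /andP[xyp /andP[yp' up]].
  rewrite inE => /orP[/eqP->|zp]; first by rewrite eqxx.
  case/splitPr: zp yp yp' up xyp => a b; rewrite cat_path /= => /and3P[ya az zb].
  rewrite mem_cat inE !negb_or => /and3P[yNa yz _].
  rewrite cat_uniq /= negb_or => /and3P[ua /andP[zNa _] _].
  rewrite -[X in _ && ~~ X]/(x \in a ++ z :: b) mem_cat inE !negb_or => /and4P[nxy xa xz _] _.
  exists (x :: y :: rcons a z); last by rewrite /= size_rcons.
  rewrite /ucycle /= exy !rcons_path last_rcons (e_sym z) exz ya az /=.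
  by rewrite !inE !mem_rcons !inE !negb_or nxy xa xz yz yNa rcons_uniq zNa ua.
have [//|[x [p [_ up sp _]]]] := grow #|T|.
by have := max_card (mem (x :: p)); rewrite (card_uniqP up) /= sp ltnn.
Qed.

Definition cycle_edges (c : seq T) : {set {set T}} := [set [set x; next c x] | x in c].

Lemma mem_cover_cycle_edges c x : (x \in cover (cycle_edges c)) = (x \in c).
Proof.
apply/bigcupP/idP => [[_ /imsetP[y yc ->]]|xc].
  by rewrite !inE => /orP[]/eqP->; rewrite ?mem_next.
by exists [set x; next c x]; rewrite ?set21 //; apply/imsetP; exists x.
Qed.

(** The union of the edges recovers the vertex set. *)
Lemma cycle_edges_neq c d x : x \in c -> x \notin d -> cycle_edges c <> cycle_edges d.
Proof. by move=> xc xd E; rewrite -mem_cover_cycle_edges -E mem_cover_cycle_edges xc in xd. Qed.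

Definition off_cycle c : rel T := [rel x y | e x y && ([set x; y] \notin cycle_edges c)].

Lemma off_cycle_sym c : symmetric (off_cycle c).
Proof. by move=> x y; rewrite /off_cycle /= e_sym setUC. Qed.

(** An ear [u] together with the two arcs [a] and [b] of the cycle forms a theta graph, in which any
    two of the three paths make up a cycle. *)
Lemma three_cycles_of_ear p s q :
    ucycle e (p :: s) -> (2 < size (p :: s))%N -> q \in s ->
    connect (off_cycle (p :: s)) p q ->
  exists C D E, [/\ is_cycle e C, is_cycle e D & is_cycle e E] /\
                [/\ C <> D, C <> E & D <> E].
Proof.
move=> cP c3 qs /connectP[t pt qt].
case/andP: (cP) => cyc /= /andP[ps us].
case/shortenP: pt qt => {}t pt ut _ qt.
have : has (mem s) t.
  apply/hasP; exists q => //; rewrite qt.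
  have := mem_last p t; rewrite inE -qt => /orP[/eqP qp|//].
  by move: ps; rewrite -qp qs.
move/(first_hit pt ut) => {t pt ut qt qs q} [u [q [pu uu qs uNs]]].
have off x y : off_cycle (p :: s) x y -> e x y by case/andP.
have epu : path e p (rcons u q) by apply: sub_path pu.
have eqr : path e q (rcons (rev u) p).
  have := rev_path e p (rcons u q); rewrite last_rcons belast_rcons rev_cons => ->.
  by rewrite (eq_path (e' := e)).
move: uu; rewrite /= mem_rcons inE negb_or rcons_uniq => /andP[/andP[pq pNu] /andP[qNu uu]].
case/splitPr: qs pu uNs cP c3 cyc ps us off => a b pu uNs cP c3 cyc ps us off.
move: (cyc); rewrite /= rcons_cat rcons_cons cat_path /= => /and3P[pa aq qb].
move: (us); rewrite cat_uniq /= negb_or => /and4P[ua /andP[qNa aNb] qNb ub].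
move: (ps); rewrite mem_cat inE !negb_or => /and3P[pNa _ pNb].
have disj x : x \in u -> [/\ x \notin a, x != q & x \notin b].
  by move=> /uNs; rewrite mem_cat inE !negb_or => /and3P.
have aNu : ~~ has (mem u) a.
  by apply/hasPn => x xa; apply/negP => /= /disj[]; rewrite xa.
have bNu : ~~ has (mem u) b.
  by apply/hasPn => x xb; apply/negP => /= /disj[_ _]; rewrite xb.
have Acyc : ucycle e (p :: a ++ q :: rev u).
  rewrite /ucycle /= rcons_cat rcons_cons cat_path /= pa aq eqr /=.
  rewrite mem_cat inE mem_rev !negb_or pNa pq pNu /= cat_uniq ua /= mem_rev qNu rev_uniq uu.
  by rewrite negb_or qNa /= has_rev has_sym aNu.
have Bcyc : ucycle e (q :: b ++ p :: u).
  rewrite /ucycle /= rcons_cat rcons_cons cat_path /=.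
  move: qb; rewrite rcons_path => /andP[-> ->]; rewrite epu /=.
  rewrite mem_cat inE !negb_or qNb eq_sym pq qNu /= cat_uniq ub /= pNu uu.
  by rewrite negb_or pNb has_sym bNu.
(* An ear that is a single edge is not an edge of the cycle, so both arcs then have inner
   vertices. *)
have short : u = [::] -> a != [::] /\ b != [::].
  move=> u0; move: pu; rewrite u0 /= andbT => /andP[_ /imsetP pq_off].
  split; apply/eqP => x0; apply: pq_off.
    by exists p; rewrite ?mem_head // x0 /= eqxx.
  exists q; first by rewrite inE mem_cat mem_head !orbT.
  rewrite x0 setUC next_nth inE mem_cat mem_head !orbT nth_default //.
  by rewrite /= (negbTE pq) index_cat (negbTE qNa) /= eqxx size_cat addn0 addn1.
exists (cycle_edges (p :: a ++ q :: b)), (cycle_edges (p :: a ++ q :: rev u)),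
  (cycle_edges (q :: b ++ p :: u)).
have long : (0 < size u)%N || (0 < size a)%N && (0 < size b)%N.
  by case: (u) short => [/(_ erefl)[]|//]; rewrite -!size_eq0 -!lt0n => -> ->.
split; first split.
- by exists (p :: a ++ q :: b).
- exists (p :: a ++ q :: rev u); split=> //.
  by rewrite /= size_cat /= size_rev; case: (u) long; case: (a) => /= *; rewrite ?addnS.
- exists (q :: b ++ p :: u); split=> //.
  by rewrite /= size_cat /=; case: (u) long => [|x u']; case: (b) => [|y b'] /=; rewrite ?andbF ?addnS.
have inA x : (x \in p :: a ++ q :: rev u) = [|| x == p, x \in a, x == q | x \in u].
  by rewrite inE mem_cat inE mem_rev.
have inB x : (x \in q :: b ++ p :: u) = [|| x == q, x \in b, x == p | x \in u].
  by rewrite inE mem_cat inE.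
have inC x : (x \in p :: a ++ q :: b) = [|| x == p, x \in a, x == q | x \in b].
  by rewrite inE mem_cat inE.
have in_a x : x \in a -> x \notin q :: b ++ p :: u.
  move=> xa; rewrite inB !negb_or; apply/and4P; split.
  - by apply: contraNneq qNa => <-.
  - by apply: contra aNb => xb; apply/hasP; exists x.
  - by apply: contraNneq pNa => <-.
  - by apply: contra aNu => xu; apply/hasP; exists x.
have in_b x : x \in b -> x \notin p :: a ++ q :: rev u.
  move=> xb; rewrite inA !negb_or; apply/and4P; split.
  - by apply: contraNneq pNb => <-.
  - by apply: contra aNb => xa; apply/hasP; exists x.
  - by apply: contraNneq qNb => <-.
  - by apply: contra bNu => xu; apply/hasP; exists x.
have in_u x : x \in u -> x \notin p :: a ++ q :: b.
  move=> xu; have [xa xq xb] := disj x xu; rewrite inC !negb_or xa xq xb !andbT.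
  by apply: contraNneq pNu => <-.
(* Each pair of cycles is separated by an inner vertex of a path lying on just one of them: [u] or
   [b], [u] or [a], and [a] or [b]. *)
split.
- case Eu: u short => [|x u']; last first.
    by move=> _; rewrite -Eu; apply/nesym/(cycle_edges_neq (x := x)); rewrite ?in_u ?inA ?Eu ?mem_head ?orbT.
  case/(_ erefl) => _; case Eb: b => [//|x b'] _; rewrite -Eu -Eb.
  by apply: (cycle_edges_neq (x := x)); rewrite ?in_b ?inC ?Eb ?mem_head ?orbT.
- case Eu: u short => [|x u']; last first.
    by move=> _; rewrite -Eu; apply/nesym/(cycle_edges_neq (x := x)); rewrite ?in_u ?inB ?Eu ?mem_head ?orbT.
  case/(_ erefl); case Ea: a => [//|x a'] _ _; rewrite -Eu -Ea.
  by apply: (cycle_edges_neq (x := x)); rewrite ?in_a ?inC ?Ea ?mem_head ?orbT.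
- case Ea: a => [|x a'].
    case Eb: b c3 => [|x b']; first by rewrite Ea.
    rewrite -Ea -Eb => _.
    by apply/nesym/(cycle_edges_neq (x := x)); rewrite ?in_b ?inB ?Eb ?mem_head ?orbT.
  by rewrite -Ea; apply: (cycle_edges_neq (x := x)); rewrite ?in_a ?inA ?Ea ?mem_head ?orbT.
Qed.

(** Unlike having exactly two cycles, this passes to subgraphs. *)
Definition no_three_cycles : Prop := forall C D E,
  is_cycle e C -> is_cycle e D -> is_cycle e E -> [\/ C = D, C = E | D = E].

(** The lost neighbours are the successor and the predecessor on the cycle, distinct because its
    length is at least 3. *)
Lemma degree_off_cycle p s : ucycle e (p :: s) -> (2 < size (p :: s))%N ->
  degree e p = (degree (off_cycle (p :: s)) p).+2.
Proof.
case: s => [|a [|b t]] // cP _; set c := p :: _.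
case/andP: (cP) => cyc uc.
have pc : p \in c by rewrite mem_head.
have np : next c p != prev c p.
  have na : next c p = a by rewrite /c /= eqxx.
  apply/eqP => E; have := next_prev uc p; rewrite -E na.
  move: uc; rewrite /= !inE !negb_or => /andP[/and3P[pa pb _] _].
  by rewrite eq_sym (negbTE pa) eqxx => bp; rewrite bp eqxx in pb.
rewrite /degree -(cardsID [set next c p; prev c p]).
have -> : [set y | e p y] :&: [set next c p; prev c p] = [set next c p; prev c p].
  apply/setIidPr/subsetP => y; rewrite !inE => /orP[]/eqP->.
    exact: (next_cycle cyc pc).
  by rewrite e_sym (prev_cycle cyc pc).
rewrite cards2 np !addSn add0n; congr _.+2; apply: eq_card => y.
rewrite !inE /off_cycle /= andbC; case: (boolP (e p y)) => //= epy; congr negb.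
apply/orP/imsetP => [[]/eqP->|[x xc E]].
- by exists p.
- by exists (prev c p); rewrite ?mem_prev // next_prev // setUC.
have yp : y != p by apply: contraTneq epy => ->; rewrite e_irr.
have := set21 p y; have := set22 p y; rewrite E !inE.
move=> /orP[]/eqP yE /orP[]/eqP pE; [by rewrite yE pE eqxx in yp| | |by rewrite yE pE eqxx in yp].
  by right; rewrite yE -(prev_next uc x) -pE.
by left; rewrite yE -pE.
Qed.

(* Suppose a cycle carried two vertices [p], [q] of excess degree. With its
   edges removed, they lie in different components, for otherwise there would
   be three cycles; then [p] is the only vertex of odd degree in its component,
   against the handshake lemma. *)
Lemma pendent_cycle (V : {set T}) k c :
    no_three_cycles -> (forall x y, e x y -> x \in V) ->
    (forall x, x \in V -> (1 < degree e x)%N) ->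
    (\sum_(x in V) degree e x + 2 = 2 * (#|V| + k))%N -> (k <= 2)%N ->
    {subset c <= V} -> ucycle e c -> (2 < size c)%N ->
  exists w s, [/\ ucycle e (w :: s), (2 < size (w :: s))%N &
                  forall x, x \in s -> degree e x = 2%N].
Proof.
move=> no3 eV d2 vol k2 cV cP c3.
(* Without excess degree on [c] any root serves; otherwise a vertex [p] of excess degree becomes the
   root. *)
have [|no] := boolP (has (fun x => (2 < degree e x)%N) c); last first.
  case: c cV cP c3 no => // w s cV cP c3 no; exists w, s; split=> // x xs.
  have := hasPn no x; rewrite inE xs orbT => /(_ isT).
  by rewrite -leqNgt => h; apply/eqP; rewrite eqn_leq h d2 // cV // inE xs orbT.
case/hasP => p pc dp; case: (rot_to pc) => i s rot_s.
have sP : ucycle e (p :: s) by rewrite -rot_s rot_ucycle.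
have s3 : (2 < size (p :: s))%N by rewrite -rot_s size_rot.
have sV x : x \in p :: s -> x \in V by rewrite -rot_s mem_rot => /cV.
exists p, s; split=> // q qs; apply/eqP.
rewrite eqn_leq d2 ?sV ?inE ?qs ?orbT // andbT leqNgt; apply/negP => dq.
have pV : p \in V by rewrite sV ?mem_head.
have qV : q \in V by rewrite sV ?inE ?qs ?orbT.
have qp : q != p by apply: contraTneq qs => ->; case/andP: sP => _ /andP[].
have off_q : ~~ connect (off_cycle (p :: s)) p q.
  apply/negP => pq; have [C [D [E [[CP DP EP] [CD CE DE]]]]] := three_cycles_of_ear sP s3 qs pq.
  by case: (no3 C D E CP DP EP).
have off_s x : x \in s -> ~~ connect (off_cycle (p :: s)) p x.
  move=> xs; apply/negP => px; have [C [D [E [[CP DP EP] [CD CE DE]]]]] :=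
    three_cycles_of_ear sP s3 xs px.
  by case: (no3 C D E CP DP EP).
(* The total excess is 2k - 2, hence at most 2, and [p] and [q] use it up with 1 each. *)
pose exc x := (degree e x - 2)%N.
have sum_exc : (\sum_(x in V) exc x <= 2)%N.
  have : (\sum_(x in V) degree e x = \sum_(x in V) exc x + #|V| * 2)%N.
    rewrite -sum_nat_const -big_split /=; apply: eq_bigr => x xV.
    by rewrite /exc subnK // d2.
  by move: vol k2; lia.
have [dp3 rest] : degree e p = 3%N /\ forall x, x \in V -> x != p -> x != q -> degree e x = 2%N.
  move: sum_exc; rewrite (bigD1 p) //= (bigD1 q) ?qV //=.
  set S := bigop _ _ _ => le2.
  have exc_p : exc p = (degree e p - 2)%N by [].
  have exc_q : exc q = (degree e q - 2)%N by [].
  split; first by lia.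
  move=> x xV xp xq; have : S == 0%N by lia.
  rewrite sum_nat_eq0 => /forallP/(_ x); rewrite xV xp xq /= /exc.
  by have := d2 x xV; lia.
pose f := off_cycle (p :: s); pose D x := connect f p x.
(* Restricting to the component of [p] while keeping the type [T] isolates all other vertices, which
   then have even degree 0. *)
pose f' := [rel x y | f x y && D x].
have f_sym : symmetric f := off_cycle_sym _.
have f'_sym : symmetric f'.
  move=> x y; rewrite /f' /= f_sym; case: (boolP (f y x)) => //= fyx.
  by apply/idP/idP => h; apply: connect_trans h (connect1 _); rewrite // f_sym.
have f'_irr : irreflexive f' by move=> x; rewrite /f' /= /f /off_cycle /= e_irr.
have := sum_degree f'_sym f'_irr; rewrite (bigD1 p) //=.
have -> : degree f' p = 1%N.
  have : degree f p = 1%N by move: dp3; rewrite (degree_off_cycle sP s3) => -[].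
  by move=> <-; apply: eq_card => y; rewrite !inE /f' /= /D connect0 andbT.
have even_rest x : x != p -> ~~ odd (degree f' x).
  move=> xp; have [Dx|Dx] := boolP (D x); last first.
    rewrite /degree (_ : [set y | f' x y] = set0) ?cards0 //.
    by apply/setP => y; rewrite !inE /f' /= (negbTE Dx) andbF.
  have xs : x \notin p :: s.
    by rewrite inE negb_or xp; apply: contraL Dx => /off_s.
  have -> : degree f' x = degree e x.
    apply: eq_card => y; rewrite !inE /f' /= Dx andbT /f /off_cycle /=.
    rewrite andb_idr // => _; apply: contra xs => xy; rewrite -mem_cover_cycle_edges.
    by apply/bigcupP; exists [set x; y]; rewrite ?set21.
  have [xV|xV] := boolP (x \in V).
    by rewrite rest //; apply: contraNneq off_q => <-.
  by rewrite /degree eq_card0 // => y; rewrite !inE; apply: contraNF xV => /eV.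
set S := bigop _ _ _ => sumE.
have even_S : ~~ odd S.
  apply: (big_ind (fun n => ~~ odd n)) => // m n /negbTE om /negbTE on.
  by rewrite oddD om on.
by have := congr1 odd sumE; rewrite add1n /= even_S oddM.
Qed.

End Cycles.

(** * Lower bounds *)

Section Networks.
Variables (T : finType) (R : realType) (rho : T -> T -> R).

(** Here [k] is the cyclomatic number: [net_volume] amounts to |E| = |V| + k - 1, stated with
    degrees to avoid truncated subtraction. *)
Record network (V : {set T}) (e : rel T) (k : nat) : Prop := {
  net_sym : symmetric e;
  net_irr : irreflexive e;
  net_sub : forall x y, e x y -> x \in V;
  net_connect : {in V &, forall x y, connect e x y};
  net_resistance : resistance_on V e rho;
  net_volume : (\sum_(x in V) degree e x + 2 = 2 * (#|V| + k))%N;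
  net_card : (0 < #|V|)%N;
  net_cycles : no_three_cycles e
}.

(** Collapsing [B] onto [w] sends each edge of a path to an edge or to a single vertex. *)
Lemma connect_induced_off (e : rel T) (B : {set T}) w u v :
    symmetric e -> w \notin B ->
    (forall k y, k \in B -> e k y -> (y \in B) || (y == w)) ->
    u \notin B -> v \notin B ->
  connect e u v -> connect (induced_off e B) u v.
Proof.
move=> e_sym wB eB uB vB; pose pi x := if x \in B then w else x.
suff : connect e u v -> connect (induced_off e B) (pi u) (pi v).
  by rewrite /pi (negbTE uB) (negbTE vB).
case/connectP => p; elim: p u {uB} => [|x p IH] u /=; first by move=> _ ->.
case/andP => eux xp /(IH _ xp); apply: connect_trans.
rewrite /pi; have [uB|uB] := boolP (u \in B).
  by case/orP: (eB _ _ uB eux) => [->//|/eqP ->]; rewrite (negbTE wB).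
have [xB|xB] := boolP (x \in B).
  move: eux; rewrite e_sym => /(eB _ _ xB).
  by rewrite (negbTE uB) => /eqP ->.
by apply: connect1; rewrite /induced_off /= eux uB.
Qed.

Lemma no_three_cycles_sub (e e' : rel T) :
  subrel e' e -> no_three_cycles e -> no_three_cycles e'.
Proof.
move=> sub no3; have up C : is_cycle e' C -> is_cycle e C.
  case=> c [/andP[cc uc] c3 ->]; exists c; split=> //.
  by rewrite /ucycle uc andbT; apply: sub_cycle cc.
by move=> C D E /up CP /up DP /up EP; apply: no3.
Qed.

(** The numerical hypothesis is the degree balance: it gives k' = k for a pendent vertex and k' = k
    - 1 for a cycle. *)
Lemma attachment_network V e k B w delta (S : R) g k' :
    network V e k -> attachment V e B w delta S g ->
    (delta * #|B|.+1 + 2 * k' = 2 * (#|B| + k))%N ->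
  network (V :\: B) (induced_off e B) k'.
Proof.
move=> net att kE; have wV' : w \in V :\: B by rewrite inE (att_rootB att) (att_rootV att).
split.
- move=> x y; rewrite /induced_off /= (net_sym net) andbCA andbC -andbA.
  by congr (_ && _); rewrite andbC.
- by move=> x; rewrite /induced_off /= (net_irr net).
- by move=> x y /and3P[exy xB _]; rewrite inE xB (net_sub net exy).
- move=> x y; rewrite !inE => /andP[xB xV] /andP[yB yV].
  apply: (connect_induced_off (net_sym net) (att_rootB att) (att_edge att)) => //.
  exact: (net_connect net).
- exact: (attachment_resistance (net_sym net) (net_resistance net) att).
- have := net_volume net; rewrite (volume_attachment (net_sym net) att) (card_attachment att).
  move: kE; clear.
  lia.
- by apply/card_gt0P; exists w.
- by apply: no_three_cycles_sub (net_cycles net) => x y /and3P[].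
Qed.

(* [2 * (#|V'| + k' - 1)] is the sum of the degrees in the smaller network. *)
Record grows (V V' : {set T}) (e e' : rel T) (w : T) (k' b delta : nat) (S : R) : Prop := {
  grow_root : w \in V';
  grow_card : #|V| = (#|V'| + b)%N;
  grow_total : total_resistance V e rho = total_resistance V' e' rho
    + (delta * b.+1)%:R * transmission V' rho w
    + b%:R * weighted_transmission V' e' rho w
    + S * (2 * (#|V'|%:R + k'%:R - 1) + (delta * (#|V'| + b))%:R);
  grow_local : forall y, y \in V -> exists2 y', y' \in V' &
    transmission V' rho y' + S <= transmission V rho y /\
    weighted_transmission V' e' rho y' + delta%:R * S <= weighted_transmission V e rho y
}.

(** For the local bounds, a vertex of [B] is compared with [w] and any other vertex with itself; the
    terms dropped are nonnegative. *)
Lemma attachment_grows V e k B w delta (S : R) g k' :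
    network V e k -> attachment V e B w delta S g ->
    network (V :\: B) (induced_off e B) k' ->
  grows V (V :\: B) e (induced_off e B) w k' #|B| delta S.
Proof.
move=> net att net'; have wV' : w \in V :\: B by rewrite inE (att_rootB att) (att_rootV att).
have [eS rP] := (net_sym net, net_resistance net).
have volE : (\sum_(v in V :\: B) degree (induced_off e B) v)%:R
    = 2 * (#|V :\: B|%:R + k'%:R - 1) :> R.
  have := congr1 (fun n => n%:R : R) (net_volume net').
  by rewrite natrD natrM natrD; lra.
split=> //.
- exact: (card_attachment att).
- by rewrite (total_attachment eS rP att) volE.
have pos := net_card net'.
move=> y yV; have [yB|yB] := boolP (y \in B).
  have h0 : 0 <= g y y.
    by rewrite -(rho_root eS rP att yB) (resistance_on_ge0 eS rP) ?(att_rootV att).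
  exists w => //; rewrite (transmission_far_side eS rP att yB) (weighted_far_side eS rP att yB).
  split; rewrite lerD2r lerDl mulr_ge0 // ?subr_ge0 ?ler1n //; exact: ler0n.
have yV' : y \in V :\: B by rewrite inE yB.
exists y => //; rewrite (transmission_root_side eS rP att yV') (weighted_root_side eS rP att yV').
have r0 : 0 <= rho y w by rewrite (resistance_on_ge0 eS rP) ?(att_rootV att).
by split; rewrite lerD2r lerDl mulr_ge0.
Qed.

(** Minimum degree 2 yields a pendent cycle and degree 1 a pendent vertex; a vertex of degree 0 is,
    by connectedness, the whole graph. *)
Lemma decompose_network V e k : network V e k -> (k <= 2)%N ->
  [\/ exists2 x, V = [set x] & k = 0%N,
      exists V' e' w, network V' e' k /\ grows V V' e e' w k 1 1 1
    | exists V' e' w k' L, [/\ (2 < L)%N, k = k'.+1, network V' e' k' &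
        grows V V' e e' w k' L.-1 2 ((L%:R ^+ 2 - 1) / 6)]].
Proof.
move=> net k2.
have [low|min2] := boolP [exists x, (x \in V) && (degree e x <= 1)%N]; last first.
  have d2 x : x \in V -> (1 < degree e x)%N.
    by move=> xV; have := existsPn min2 x; rewrite xV /= -ltnNge.
  have [x0 x0V] := card_gt0P (net_card net).
  have [c cP c3] := cycle_of_min_degree2 (net_sym net) (net_irr net) (net_sub net) d2 x0V.
  have cV : {subset c <= V}.
    move=> x xc; case/andP: cP => cc _; exact: (net_sub net (next_cycle cc xc)).
  have [w [s [sP s3 s2]]] := pendent_cycle (net_sym net) (net_irr net) (net_cycles net)
    (net_sub net) d2 (net_volume net) k2 cV cP c3.
  have att := cycle_attachment R (net_sym net) (net_sub net) sP s3 s2.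
  (* Minimum degree 2 forces k to be positive, so [k.-1] is a true predecessor. *)
  have k0 : (0 < k)%N.
    have : (#|V| * 2 <= \sum_(x in V) degree e x)%N.
      by rewrite -sum_nat_const; apply: leq_sum => x /d2.
    by have := net_volume net; clear; lia.
  have card_s : #|[set x in s]| = size s.
    by rewrite cardsE; apply/card_uniqP; case/andP: sP => _ /andP[].
  have net' := attachment_network (k' := k.-1) net att.
  rewrite card_s in net'; have {}net' := net' ltac:(move: k0; clear; lia).
  apply: Or33; exists (V :\: [set x in s]), (induced_off e [set x in s]), w, k.-1, (size s).+1.
  split=> //; first by rewrite prednK.
  by have := attachment_grows net att net'; rewrite card_s.
case/existsP: low => a /andP[aV]; rewrite leq_eqVlt ltnS leqn0 => /orP[/eqP a1|/eqP a0].
  have /card_gt0P[w] : (0 < degree e a)%N by rewrite a1.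
  rewrite inE => eaw.
  have att := leaf_attachment R (net_sym net) (net_irr net) (net_sub net) a1 eaw.
  have net' : network (V :\: [set a]) (induced_off e [set a]) k.
    by apply: attachment_network net att _; rewrite cards1; clear; lia.
  apply: Or32; exists (V :\: [set a]), (induced_off e [set a]), w; split=> //.
  by have := attachment_grows net att net'; rewrite cards1.
have VE : V = [set a].
  apply/eqP; rewrite eqEsubset sub1set aV andbT; apply/subsetP => x xV.
  case/connectP: (net_connect net aV xV) => -[|y p] /=; first by move=> _ ->; rewrite inE.
  case/andP => eay _ _; move/eqP: a0; rewrite -leqn0 leqNgt => /negP[].
  by apply/card_gt0P; exists y; rewrite inE.
apply: Or31; exists a => //.
by have := net_volume net; rewrite VE big_set1 cards1 a0; clear; lia.
Qed.

Lemma total_resistance1 (e : rel T) x : network [set x] e 0 ->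
  total_resistance [set x] e rho = 0.
Proof.
move=> net; rewrite /total_resistance /weighted_transmission !big_set1.
by rewrite (resistance_on_id (net_resistance net)) ?mulr0 // inE.
Qed.

(** The star attains the bound on the total, and its centre both local bounds. *)
Lemma tree_bounds V e : network V e 0 ->
  (#|V|%:R - 1) * (3 * #|V|%:R - 4) <= total_resistance V e rho /\
  forall y, y \in V -> #|V|%:R - 1 <= transmission V rho y /\
                       #|V|%:R - 1 <= weighted_transmission V e rho y.
Proof.
have [n] := ubnP #|V|; elim: n V e => // n IH V e /ltnSE Vn net.
case: (decompose_network net) => // [[x VE _]|[V' [e' [w [net' gr]]]]|]; last first.
- by case=> V' [e' [w [k' [L []]]]].
- have V'n : (#|V'| < n)%N by move: Vn; rewrite (grow_card gr) addn1.
  have [IHD IHloc] := IH _ _ V'n net'.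
  have [IHR IHW] := IHloc _ (grow_root gr).
  have N1 : 1 <= #|V'|%:R :> R by rewrite ler1n (net_card net').
  rewrite (grow_total gr) (grow_card gr) !natrD natrM.
  split; first by move: IHD IHR IHW; nra.
  move=> y /(grow_local gr)[y' y'V' []].
  by have [] := IHloc _ y'V'; lra.
- rewrite VE cards1 subrr mul0r; rewrite VE in net.
  rewrite (total_resistance1 net); split=> // y /set1P ->.
  rewrite /transmission /weighted_transmission !big_set1.
  by rewrite (resistance_on_id (net_resistance net)) ?mulr0 // inE.
Qed.

(* [K] is the length of the cycle. It has to be recorded: for K = 4, 5, 6 the
   total may be smaller than 3 N^2 - 17/3 N - 2, its minimum for K = 3, but then
   the transmissions are larger, which makes up for the loss once the second
   cycle is attached. *)
Lemma unicyclic_bounds V e : network V e 1 ->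
  exists2 K, (2 < K <= #|V|)%N &
  3 * #|V|%:R ^+ 2 - 17 / 3 * #|V|%:R - 3 * K%:R ^+ 2 + 17 / 3 * K%:R
    + (K%:R ^+ 3 - K%:R) / 3 <= total_resistance V e rho /\
  forall y, y \in V ->
    #|V|%:R - 1 + (K%:R - 1) * (K%:R - 5) / 6 <= transmission V rho y /\
    #|V|%:R - 1 + (K%:R - 1) * (K%:R - 2) / 3 <= weighted_transmission V e rho y.
Proof.
have [n] := ubnP #|V|; elim: n V e => // n IH V e /ltnSE Vn net.
case: (decompose_network net) => // [[x VE //]|[V' [e' [w [net' gr]]]]|].
- have V'n : (#|V'| < n)%N by move: Vn; rewrite (grow_card gr) addn1.
  have [K K3 [IHD IHloc]] := IH _ _ V'n net'.
  have [IHR IHW] := IHloc _ (grow_root gr).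
  exists K; first by rewrite (grow_card gr); move: K3; clear; lia.
  rewrite (grow_total gr) (grow_card gr) !natrD natrM.
  split; last by move=> y /(grow_local gr)[y' /IHloc[]]; lra.
  have K3R : 3 <= K%:R :> R by rewrite ler_nat; case/andP: K3.
  (* The slack is (K - 3)(2K - 3)/3, nonnegative for K at least 3. *)
  by move: IHD IHR IHW; nra.
- case=> V' [e' [w [k' [K [K3 [kE] net' gr]]]]]; rewrite -kE in net' gr.
  have [D0 loc0] := tree_bounds net'.
  have [R0 W0] := loc0 _ (grow_root gr).
  have N1 : 1 <= #|V'|%:R :> R by rewrite ler1n (net_card net').
  have K3R : 3 <= K%:R :> R by rewrite ler_nat.
  have Kp : K.-1%:R = K%:R - 1 :> R by rewrite -[in RHS](@prednK K) ?(ltnW (ltnW K3)) // -natr1 addrK.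
  exists K; first by rewrite (grow_card gr) K3; have := net_card net'; move: K3; clear; lia.
  rewrite (grow_total gr) (grow_card gr) prednK ?(ltnW (ltnW K3)) // !natrM !natrD Kp.
  split; last by move=> y /(grow_local gr)[y' /loc0[]]; lra.
  (* Once the tree quantities are replaced by their bounds, the slack is one third of this product;
     [c1] and [c2] account for the replacements in R and W. *)
  have c0 : 0 <= (#|V'|%:R - 1) * ((K%:R - 3) * (2 * K%:R - 3)) :> R.
    by rewrite mulr_ge0 ?mulr_ge0 ?subr_ge0 //; lra.
  have c1 : 0 <= (2 * K%:R) * (transmission V' rho w - (#|V'|%:R - 1)).
    by rewrite mulr_ge0 ?subr_ge0 //; lra.
  have c2 : 0 <= (K%:R - 1) * (weighted_transmission V' e' rho w - (#|V'|%:R - 1)).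
    by rewrite mulr_ge0 ?subr_ge0 //; lra.
  by rewrite mulr0n; lra.
Qed.

(** A pendent vertex involves only the combination 2R + W, whose bound yields exactly the increment
    of the formula. The 4/3 is a loss of 2/3 for each of two triangles; a longer cycle of length K
    does better by (K - 3)(2K - 3)/3. *)
Lemma bicyclic_bounds V e : network V e 2 ->
  3 * #|V|%:R ^+ 2 - 13 / 3 * #|V|%:R - 32 / 3 <= total_resistance V e rho /\
  forall y, y \in V -> 3 * (#|V|%:R - 1) - 4 / 3 <=
    2 * transmission V rho y + weighted_transmission V e rho y.
Proof.
have [n] := ubnP #|V|; elim: n V e => // n IH V e /ltnSE Vn net.
case: (decompose_network net) => // [[x VE //]|[V' [e' [w [net' gr]]]]|].
- have V'n : (#|V'| < n)%N by move: Vn; rewrite (grow_card gr) addn1.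
  have [IHD IHloc] := IH _ _ V'n net'.
  have IHQ := IHloc _ (grow_root gr).
  rewrite (grow_total gr) (grow_card gr) !natrD natrM.
  by split; [lra | move=> y /(grow_local gr)[y' /IHloc]; lra].
- case=> V' [e' [w [k' [L [L3 [kE] net' gr]]]]]; rewrite -kE in net' gr.
  have [K /andP[K3 KV] [D1 loc1]] := unicyclic_bounds net'.
  have [R1 W1] := loc1 _ (grow_root gr).
  have N3 : 3 <= #|V'|%:R :> R by rewrite ler_nat (leq_trans K3).
  have L3R : 3 <= L%:R :> R by rewrite ler_nat.
  have K3R : 3 <= K%:R :> R by rewrite ler_nat.
  have Lp : L.-1%:R = L%:R - 1 :> R by rewrite -[in RHS](@prednK L) ?(ltnW (ltnW L3)) // -natr1 addrK.
  (* Integrality matters: for L = 3 the slack is (K - 3)(K^2 - K - 11)/3, negative for real K just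
     above 3. *)
  have K34 : K%:R = 3 :> R \/ 4 <= K%:R :> R.
    by move: K3; rewrite leq_eqVlt => /orP[/eqP <-|K4]; [left | right; rewrite ler_nat].
  rewrite (grow_total gr) (grow_card gr) prednK ?(ltnW (ltnW L3)) // !natrM !natrD Lp.
  split; last first.
    move=> y /(grow_local gr)[y' /loc1[r1 w1]].
    have cK : 0 <= (K%:R - 3) * (2 * K%:R - 3) :> R by rewrite mulr_ge0 ?subr_ge0 //; lra.
    have cL : 0 <= (L%:R - 3) * (2 * L%:R - 3) :> R by rewrite mulr_ge0 ?subr_ge0 //; lra.
    lra.
  have c1 : 0 <= (2 * L%:R) * (transmission V' rho w -
      (#|V'|%:R - 1 + (K%:R - 1) * (K%:R - 5) / 6)).
    by rewrite mulr_ge0 ?subr_ge0 //; lra.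
  have c2 : 0 <= (L%:R - 1) * (weighted_transmission V' e' rho w -
      (#|V'|%:R - 1 + (K%:R - 1) * (K%:R - 2) / 3)).
    by rewrite mulr_ge0 ?subr_ge0 //; lra.
  (* Shifted to nonnegative variables, the slack is a linear combination of the products collected
     below, which [lra] can find. *)
  have [c [cE c_ge0]] : exists c : R, #|V'|%:R = 3 + c /\ 0 <= c.
    by exists (#|V'|%:R - 3); split; lra.
  (* Integrality of L enters as b(b - 1) >= 0; at K = 3 and [c] = 0 the slack is (b^3 + 5b(b -
     1))/3. *)
  have [b [bE [b_ge0 bb]]] : exists b : R, L%:R = 3 + b /\ 0 <= b /\ 0 <= b * (b - 1).
    exists (L%:R - 3); split; [lra | split; first lra].
    move: L3; rewrite leq_eqVlt => /orP[/eqP <-|L4]; first by rewrite subrr mul0r.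
    by have : 4 <= L%:R :> R; [rewrite ler_nat | move=> ?; rewrite mulr_ge0 //; lra].
  have b2c : 0 <= b * b * c by rewrite !mulr_ge0.
  have bc : 0 <= b * c by rewrite mulr_ge0.
  have b3 : 0 <= b * b * b by rewrite !mulr_ge0.
  case: K34 => [KE|K4].
    by move: D1 c1 c2; rewrite KE cE bE; lra.
  have [a [aE a_ge0]] : exists a : R, K%:R = 4 + a /\ 0 <= a.
    by exists (K%:R - 4); split; lra.
  have ab : 0 <= a * b by rewrite mulr_ge0.
  have a2b : 0 <= a * a * b by rewrite !mulr_ge0.
  have a2 : 0 <= a * a by rewrite mulr_ge0.
  have b2 : 0 <= b * b by rewrite mulr_ge0.
  have a3 : 0 <= a * a * a by rewrite !mulr_ge0.
  move: D1 c1 c2; rewrite aE cE bE; lra.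
Qed.

End Networks.

(** * The extremal graph *)

(** The diagonal vanishes, and by symmetry the half below it folds onto the half above. *)
Lemma degree_resistance_distanceE (T : finType) (e : rel T) (R : realType) :
    symmetric e -> resistance_on [set: T] e (resistance e R) ->
  degree_resistance_distance e R = total_resistance [set: T] e (resistance e R).
Proof.
move=> e_sym rhoP; set rho := resistance e R.
have rhoC u v : rho u v = rho v u by apply: (resistance_on_sym rhoP); rewrite inE.
have rho0 u : rho u u = 0 by apply: (resistance_on_id rhoP); rewrite inE.
pose lt (u v : T) := (enum_rank u < enum_rank v)%N.
have split_row u : \sum_v (degree e v)%:R * rho u v =
    \sum_(v | lt u v) (degree e v)%:R * rho u v + \sum_(v | lt v u) (degree e v)%:R * rho u v.
  rewrite (bigID (lt u)) /=; congr (_ + _).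
  rewrite (bigD1 u) /=; last by rewrite /lt ltnn.
  rewrite rho0 mulr0 add0r; apply: eq_bigl => v; rewrite /lt -leqNgt leq_eqVlt.
  have -> : (v != u) = (enum_rank v != enum_rank u :> nat).
    by rewrite (inj_eq val_inj) (inj_eq enum_rank_inj).
  by case: ltngtP.
have -> : total_resistance [set: T] e rho = \sum_u \sum_v (degree e v)%:R * rho u v.
  rewrite /total_resistance /weighted_transmission; apply: eq_big => [u|u _]; first by rewrite inE.
  by apply: eq_bigl => v; rewrite inE.
under [RHS]eq_bigr do rewrite split_row.
rewrite big_split /= [X in _ + X](exchange_big_dep xpredT) //= -big_split /=.
apply: eq_bigr => u _; rewrite -big_split /=; apply: eq_bigr => v _.
by rewrite -/rho natrD mulrDl addrC (rhoC v u).
Qed.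

Lemma resistance_on_setT (T : finType) (e : rel T) (R : realType) :
  symmetric e -> connected_graph e -> resistance_on [set: T] e (resistance e R).
Proof.
move=> e_sym e_conn u v _ _; split; first exact: unit_current_potential_ex.
by move=> phi; apply: resistanceP.
Qed.

Lemma bicyclic_network (T : finType) (e : rel T) (R : realType) :
    (0 < #|T|)%N -> simple_graph e -> bicyclic e -> exactly_two_cycles e ->
  network (resistance e R) [set: T] e 2.
Proof.
move=> T0 [e_sym e_irr] [e_conn e_edges] [C1 [C2 [_ _ _ two]]]; split=> //.
- exact: resistance_on_setT.
- rewrite (eq_bigl xpredT) => [|x]; last by rewrite inE.
  by rewrite sum_degree // e_edges cardsT; clear; lia.
- by rewrite cardsT.
- by move=> C D E /two[->|->] /two[->|->] /two[->|->]; (by constructor 1) || (by constructor 2) || (by constructor 3).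
Qed.

(** * Degrees and resistances in the extremal graph *)

Section S33.
Variables (R : realType) (m : nat).
Local Notation n := m.+4.+1.
Local Notation e := (S33 n).

Lemma big_ord5 (M : nmodType) (F : nat -> M) :
  \sum_(i < n) F i = F 0 + F 1 + F 2 + F 3 + F 4 + \sum_(i < m) F i.+4.+1.
Proof. by rewrite !big_ord_recl /= !addrA. Qed.

(* Potential at [w] of a unit current from [u] to the common vertex 0. *)
Definition S33_green (u w : nat) : R :=
  match u, w with
  | 1, 1 | 2, 2 | 3, 3 | 4, 4 => 2 / 3
  | 1, 2 | 2, 1 | 3, 4 | 4, 3 => 1 / 3
  | u'.+4.+1, w'.+4.+1 => (u' == w')%:R
  | _, _ => 0
  end.

Definition S33_degree (w : nat) : nat :=
  match w with 0 => m.+4 | w'.+4.+1 => 1 | _ => 2 end.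

Lemma S33_sym : symmetric e.
Proof.
move=> x y; rewrite /S33 eq_sym; congr (_ && _).
rewrite orbCA; congr [|| _, _ | _].
by rewrite !inE !xpair_eqE; do 8![case: eqP => ? //=].
Qed.

Lemma S33_irr : irreflexive e.
Proof. by move=> x; rewrite /S33 eqxx. Qed.

Lemma S33_connected : connected_graph e.
Proof.
have to0 x : connect e x ord0.
  have [->|x0] := eqVneq x ord0; first exact: connect0.
  by apply: connect1; rewrite /S33 x0 /= orbT.
move=> x y; apply: connect_trans (to0 x) _.
by rewrite (sym_connect_sym S33_sym).
Qed.

(** Adjacency on plain naturals, so that sums over the ordinals can be split by [big_ord5]. *)
Definition adj33 (i j : nat) : bool :=
  (i != j) && [|| i == 0, j == 0 | (i, j) \in [:: (1, 2); (2, 1); (3, 4); (4, 3)]]%N.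

Lemma sum_delta_ord (u : nat) : (u < m)%N -> \sum_(i < m) (u == i)%:R = 1 :> R.
Proof.
move=> um; rewrite (bigD1 (Ordinal um)) //= eqxx big1 ?addr0 // => i.
by rewrite -(inj_eq val_inj) /= eq_sym => /negbTE ->.
Qed.

Lemma degree_S33 (w : 'I_n) : degree e w = S33_degree w.
Proof.
rewrite /degree -sum1dep_card big_mkcond /=.
rewrite (@big_ord5 nat (fun j => if adj33 w j then 1%N else 0%N)).
case: w => -[|[|[|[|[|w]]]]] wn /=.
  by transitivity (4 + \sum_(i < m) 1)%N; rewrite ?big_const_ord ?iter_addn; lia.
all: by rewrite big1 // => i _; rewrite /adj33 !inE /= ?andbF.
Qed.

Lemma S33_potential (u : 'I_n) :
  unit_current_potential e u ord0 (fun w : 'I_n => S33_green u w).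
Proof.
move=> w; rewrite big_mkcond /=.
rewrite (big_ord5 (fun j : nat => if adj33 w j then
  S33_green u w - S33_green u j else 0)) -!(inj_eq val_inj).
case: w => -[|[|[|[|[|w]]]]] wn; last first.
all: case: u => -[|[|[|[|[|u]]]]] un.
all: rewrite /adj33 /=.
all: try by rewrite big1 => [|i _]; rewrite ?inE /= ?andbF; lra.
- rewrite big1 => [|i _]; last by rewrite !inE /= andbF.
  by rewrite !eqSS eq_sym; lra.
- by rewrite sumrB big1 // sum_delta_ord //; lra.
Qed.

Lemma resistance_S33 (u v : 'I_n) :
  resistance e R u v =
  S33_green u u + S33_green v v - S33_green u v - S33_green v u.
Proof.
rewrite (resistanceP S33_sym S33_connected
  (unit_current_potentialB (S33_potential u) (S33_potential v))); ring.
Qed.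

Lemma degree_resistance_distance_S33 :
  degree_resistance_distance e R = 3 * n%:R ^+ 2 - 13 / 3 * n%:R - 32 / 3.
Proof.
rewrite degree_resistance_distanceE; last exact: resistance_on_setT S33_sym S33_connected.
  2: exact: S33_sym.
rewrite /total_resistance /weighted_transmission.
pose F (u v : nat) : R := (S33_degree v)%:R *
  (S33_green u u + S33_green v v - S33_green u v - S33_green v u).
pose W (u : nat) := \sum_(v < n) F u v.
transitivity (\sum_(u < n) W u).
  apply: eq_big => [u|u _]; first by rewrite inE.
  apply: eq_big => [v|v _]; first by rewrite inE.
  by rewrite degree_S33 resistance_S33.
(* Row sums at the common vertex, a pendent vertex and a triangle vertex, in this order. *)
have WE u : (u < n)%N -> W u = match u with
    | 0 => 16 / 3 + m%:R | u'.+4.+1 => 3 * m%:R + 46 / 3 | _ => 7 / 3 * m%:R + 28 / 3 end.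
  move=> un; rewrite /W (big_ord5 (F u)) /F.
  have m4 : m.+4%:R = m%:R + 4 :> R by rewrite -addn4 natrD.
  have tail (c : R) : \sum_(i < m) 1 * (c + (i == i)%:R - 0 - 0) = (c + 1) * m%:R.
    rewrite (eq_bigr (fun=> c + 1)) => [|i _]; last by rewrite eqxx mulr1n; ring.
    by rewrite sumr_const card_ord mulr_natr.
  case: u un => [|[|[|[|[|u]]]]] un /=; rewrite ?tail ?m4; try lra.
  rewrite (eq_bigr (fun i : 'I_m => 2 - 2 * (u == i)%:R)) => [|i _]; last first.
    by rewrite !eqxx mulr1n (eq_sym (i : nat)); ring.
  by rewrite sumrB sumr_const card_ord -mulr_sumr sum_delta_ord // -mulr_natr eqxx mulr1n; lra.
rewrite (big_ord5 W) !WE // (eq_bigr (fun=> 3 * m%:R + 46 / 3)) => [|i _]; last first.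
  by rewrite (WE _ (ltn_ord i : (i.+4.+1 < n)%N)).
have m5 : n%:R = m%:R + 5 :> R by rewrite -[n]/(5 + m)%N natrD addrC.
by rewrite sumr_const card_ord -[(3 * m%:R + 46 / 3) *+ m]mulr_natr m5 /=; lra.
Qed.

(** Edges are counted by the handshake lemma: the degrees sum to (m + 4) + 8 + m = 2(n + 1). *)
Lemma S33_bicyclic : bicyclic e.
Proof.
split; first exact: S33_connected.
have := sum_degree S33_sym S33_irr; under eq_bigr do rewrite degree_S33.
rewrite (@big_ord5 nat S33_degree) /= card_ord.
set t := bigop _ _ _; have -> : t = m.
  by transitivity (\sum_(i < m) 1)%N; [by [] | rewrite big_const_ord iter_addn; lia].
by rewrite -[Algebra.add]/addn; lia.
Qed.

End S33.

(** * The cycles of the extremal graph *)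

Lemma cycle_edges_rot (T : finType) i (c : seq T) :
  uniq c -> cycle_edges (rot i c) = cycle_edges c.
Proof.
move=> uc; apply/setP => X; apply/imsetP/imsetP => -[x xc ->]; exists x.
- by rewrite mem_rot in xc.
- by rewrite next_rot.
- by rewrite mem_rot.
- by rewrite next_rot.
Qed.

Lemma cycle_edges_triangle (T : finType) (a b c : T) : uniq [:: a; b; c] ->
  cycle_edges [:: a; b; c] = [set [set a; b]; [set b; c]; [set c; a]].
Proof.
rewrite /= !inE negb_or andbT => /andP[/andP[ab ac] bc].
have na : next [:: a; b; c] a = b by rewrite /= eqxx.
have nb : next [:: a; b; c] b = c by rewrite /= eq_sym (negbTE ab) eqxx.
have nc : next [:: a; b; c] c = a.
  by rewrite /= eq_sym (negbTE ac) eq_sym (negbTE bc) eqxx.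
apply/setP => X; rewrite !inE; apply/imsetP/idP => [[x]|].
  by rewrite !inE => /or3P[]/eqP-> ->; rewrite ?na ?nb ?nc eqxx ?orbT.
by case/orP => [/orP[]|] /eqP ->; [exists a | exists b | exists c];
  rewrite ?na ?nb ?nc // !inE eqxx ?orbT.
Qed.

(** Away from the common vertex only the edges 12 and 34 remain. Hence every cycle passes through 0,
    and between two visits to 0 it has room for just one of these edges. *)
Lemma S33_exactly_two_cycles m : exactly_two_cycles (S33 m.+4.+1).
Proof.
set n := m.+4.+1; pose o k (kn : (k < n)%N) : 'I_n := Ordinal kn.
pose o0 := o 0 isT; pose o1 := o 1 isT; pose o2 := o 2 isT; pose o3 := o 3 isT; pose o4 := o 4 isT.
exists (cycle_edges [:: o0; o1; o2]), (cycle_edges [:: o0; o3; o4]); split.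
- by exists [:: o0; o1; o2].
- by exists [:: o0; o3; o4].
- exact: (cycle_edges_neq (x := o1)).
have step (x y : 'I_n) : S33 n x y -> x != o0 -> y != o0 ->
    (x, y) \in [:: (o1, o2); (o2, o1); (o3, o4); (o4, o3)].
  rewrite /S33 -!(inj_eq val_inj) /= => /andP[_] + x0 y0.
  by rewrite (negbTE x0) (negbTE y0) /= !inE !xpair_eqE -!(inj_eq val_inj).
(* Off 0 the graph is a matching, so a walk can only turn back. *)
have back (x y z : 'I_n) : S33 n x y -> S33 n y z -> x != o0 -> y != o0 -> z != o0 -> x = z.
  move=> xy yz x0 y0 z0; have := step _ _ xy x0 y0; have := step _ _ yz y0 z0.
  by rewrite !inE !xpair_eqE => /or4P[] /andP[/eqP -> /eqP ->] /or4P[] /andP[/eqP -> /eqP].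
move=> _ [c [cP c3 ->]]; rewrite -/(cycle_edges c).
have [cc uc] := andP cP.
have c0 : o0 \in c.
  apply/negPn/negP => oc; case: c {cP} cc uc c3 oc => [|x [|y [|z t]]] //=.
  move=> /and3P[xy yz _] /andP[xu _] _ oc.
  have := xu; rewrite !inE !negb_or (back x y z) ?eqxx ?andbF //;
    by apply: contraNneq oc => <-; rewrite !inE eqxx ?orbT.
case: (rot_to c0) => i [|x [|y t]] rot_c; try by move: c3; rewrite -(size_rot i) rot_c.
have [cc' uc'] : cycle (S33 n) [:: o0, x, y & t] /\ uniq [:: o0, x, y & t].
  by rewrite -rot_c rot_cycle rot_uniq.
rewrite -(cycle_edges_rot i uc) rot_c.
move: (cc') (uc'); rewrite /= !inE !negb_or.
move=> /and3P[_ xy yt] /and4P[/and3P[x0 y0 t0] /andP[xny xt] yNt ut].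
case: t => [|z t] in rot_c cc' uc' yt t0 xt yNt ut *; last first.
  case/andP: yt => yz _; move: t0 xt; rewrite !inE !negb_or => /andP[z0 _] /andP[xz _].
  by rewrite (back x y z) ?eqxx // eq_sym in xz.
have := step x y xy; rewrite eq_sym x0 eq_sym y0 => /(_ isT isT).
(* Both orientations of a triangle have the same edge set. *)
have flip (a b d : 'I_n) : uniq [:: a; b; d] -> cycle_edges [:: a; d; b] = cycle_edges [:: a; b; d].
  move=> u; rewrite !cycle_edges_triangle //; last first.
    by move: u; rewrite /= !inE !negb_or (eq_sym d) [(a != d) && _]andbC.
  rewrite (setUC [set a] [set d]) (setUC [set d] [set b]) (setUC [set b] [set a]).
  by rewrite [LHS]setUC [LHS]setUA [LHS]setUAC.
rewrite !inE !xpair_eqE => /or4P[]/andP[/eqP-> /eqP->]; [left|left|right|right] => //; exact: flip.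
Qed.

Theorem theorem4p1 (R : realType) (n : nat) (hn : (5 <= n)%N) :
  [/\ simple_graph (S33 n),
      bicyclic (S33 n),
      exactly_two_cycles (S33 n),
      forall (T : finType) (e : rel T),
        simple_graph e -> #|T| = n -> bicyclic e -> exactly_two_cycles e ->
        degree_resistance_distance (S33 n) R <= degree_resistance_distance e R
    & degree_resistance_distance (S33 n) R
      = 3 * n%:R ^+ 2 - 13 / 3 * n%:R - 32 / 3].
Proof.
case: n hn => [|[|[|[|[|m]]]]] // _.
have DS := degree_resistance_distance_S33 R m; split=> //.
- by split; [exact: S33_sym | exact: S33_irr].
- exact: S33_bicyclic.
- exact: S33_exactly_two_cycles.
move=> T e e_simple Tn e_bi e_two; have [e_sym _] := e_simple; have [e_conn _] := e_bi.
rewrite DS (degree_resistance_distanceE e_sym (resistance_on_setT R e_sym e_conn)).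
have T0 : (0 < #|T|)%N by rewrite Tn.
by have [+ _] := bicyclic_bounds (bicyclic_network R T0 e_simple e_bi e_two); rewrite cardsT Tn.
Qed.
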